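(* Let $S^1=\mathbb{R}/2\pi\mathbb{Z}$ be the unit circle equipped with the arc-length distance $d$ and the uniform probability measure $\mu=\frac{d\theta}{2\pi}$. Let $T_{K_B}$ be the MDS integral operator of the metric measure space $(S^1,d,\mu)$. Then the (complex) eigenfunctions of $T_{K_B}$ are $\phi_k(x)=e^{ikx}$, $k\in\mathbb{Z}$, where $\phi_0=1$ has eigenvalue $0$ and, for $k\neq 0$, $\phi_k$ has eigenvalue $$\lambda_k=\frac{(-1)^{k+1}}{k^2}.$$ Consequently, using the real orthonormal eigenfunctions $\sqrt2\cos k\theta$, $\sqrt2\sin k\theta$, the MDS embedding of $S^1$ into $\ell^2$ is $$\gamma(\theta)=\sqrt{2}\left(\cos\theta,\ \sin\theta,\ \tfrac13\cos3\theta,\ \tfrac13\sin3\theta,\ \tfrac15\cos5\theta,\ \tfrac15\sin5\theta,\ldots\right)\in\ell^2 ,$$ and $\|\gamma(\theta)\|_{\ell^2}=\frac{\pi}{2}$ for all $\theta\in S^1$; that is, MDS maps $S^1$ into the sphere of radius $\frac{\pi}{2}$ centered at the origin in $\ell^2$.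
   Context: A metric measure space $(X,d,\mu)$ is a compact metric space $(X,d)$ with a Borel probability measure $\mu$. Multidimensional scaling (MDS) on $(X,d,\mu)$ is defined as follows. Let $K_A(x,s)=-\tfrac12 d^2(x,s)$ and $$K_B(x,s)=K_A(x,s)-\int_X K_A(w,s)\,\mu(dw)-\int_X K_A(x,z)\,\mu(dz)+\int_X\int_X K_A(w,z)\,\mu(dw)\,\mu(dz).$$ The MDS integral operator $T_{K_B}\colon L^2(X,\mu)\to L^2(X,\mu)$ is $[T_{K_B}\phi](x)=\int_X K_B(x,s)\phi(s)\,\mu(ds)$; it is a self-adjoint Hilbert--Schmidt operator (and is applied to complex-valued functions by the same formula). Let $\lambda_1\ge\lambda_2\ge\cdots$ be its eigenvalues (with multiplicity) with an orthonormal system of real eigenfunctions $\phi_1,\phi_2,\ldots\in L^2(X,\mu)$, and let $\hat\lambda_i=\max(\lambda_i,0)$. The MDS embedding of $X$ into $\ell^2$ is the map $$x\mapsto\left(\sqrt{\hat\lambda_1}\,\phi_1(x),\ \sqrt{\hat\lambda_2}\,\phi_2(x),\ \ldots\right).$$ Thus only coordinates corresponding to positive eigenvalues, listed in decreasing order of eigenvalue, contribute; coordinates for nonpositive eigenvalues are zero and are omitted. The statement that ''the eigenfunctions are $\phi_k$, $k\in\mathbb{Z}$'' means that these functions form an orthonormal basis of complex $L^2(S^1,\mu)$ consisting of eigenfunctions of $T_{K_B}$ with the stated eigenvalues. *)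

(* Defs.v *)
From HB Require Import structures.
From mathcomp Require Import all_boot all_order all_algebra.
From mathcomp Require Import generic_quotient ring_quotient.
From mathcomp Require Import all_classical all_reals all_analysis.
From mathcomp Require Import measurable_realfun.
From mathcomp Require Import complex ring lra.

Set Implicit Arguments.
Unset Strict Implicit.
Unset Printing Implicit Defensive.

Import Order.TTheory GRing.Theory Num.Theory.
Import numFieldNormedType.Exports.

Local Open Scope classical_set_scope.
Local Open Scope ring_scope.

(** * Real and complex L^2

   Elements of L^2 are represented by functions, and equality in L^2 is
   equality almost everywhere. The real space is [Lfun mu 2%:E]. *)

Section real_L2.
Context {d : measure_display} {T : measurableType d} {R : realType}.
Variable mu : {measure set T -> \bar R}.

Definition rdot (f g : T -> R) : R := \int[mu]_x (f x * g x).

Definition rorthonormal (I : eqType) (phi : I -> T -> R) :=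
  (forall i, phi i \in Lfun mu 2%:E) /\
  (forall i j, rdot (phi i) (phi j) = (i == j)%:R).

Definition reigenfunction (A : (T -> R) -> T -> R) (l : R) (f : T -> R) :=
  [/\ f \in Lfun mu 2%:E,
      ~ (f = (fun=> 0) %[ae mu])
    & A f = (fun x => l * f x) %[ae mu]].

End real_L2.

Section complex_L2.
Context {d : measure_display} {T : measurableType d} {R : realType}.
Variable mu : {measure set T -> \bar R}.

Definition cL2 (f : T -> R[i]) :=
  ((fun x => complex.Re (f x)) \in Lfun mu 2%:E) /\
  ((fun x => complex.Im (f x)) \in Lfun mu 2%:E).

Definition cintegral (f : T -> R[i]) : R[i] :=
  ((\int[mu]_x complex.Re (f x)) +i* (\int[mu]_x complex.Im (f x)))%C.

Definition cdot (f g : T -> R[i]) : R[i] :=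
  cintegral (fun x => f x * (g x)^*%C).

Definition cL2norm (f : T -> R[i]) : \bar R :=
  ('N[mu]_2%:E [(fun x => (Normc.normc (f x))%:E)])%E.

Definition corthonormal (I : eqType) (phi : I -> T -> R[i]) :=
  (forall i, cL2 (phi i)) /\
  (forall i j, cdot (phi i) (phi j) = (i == j)%:R).

(* Hilbert basis: orthonormal, with L^2-dense span of finite combinations. *)
Definition corthonormal_basis (I : eqType) (phi : I -> T -> R[i]) :=
  corthonormal phi /\
  (forall f, cL2 f -> forall e : R, 0 < e ->
    exists (s : seq I) (c : I -> R[i]),
      (cL2norm (fun x => f x - \sum_(i <- s) c i * phi i x)%R < e%:E)%E).

Definition ceigenfunction (A : (T -> R[i]) -> T -> R[i]) (l : R[i])
    (f : T -> R[i]) :=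
  [/\ cL2 f,
      ~ (f = (fun=> 0) %[ae mu])
    & A f = (fun x => l * f x) %[ae mu]].

End complex_L2.

(** * Metric measure spaces and multidimensional scaling *)

(* The distinguished point is only there because the library builds generated
   sigma-algebras on pointed types; it is not used otherwise. *)
#[short(type="pmetricType")]
HB.structure Definition PointedMetric (K : numDomainType) :=
  {T of Metric K T & Pointed T}.

Definition borel {K : numDomainType} (X : pmetricType K) :=
  g_sigma_algebraType (@open X).

Record mmSpace (R : realType) := MMSpace {
  mm_sort :> pmetricType R;
  mm_compact : compact [set: mm_sort];
  mm_measure : probability (borel mm_sort) R
}.

Section MDS.
Context {R : realType} (X : mmSpace R).
Local Notation mu := (mm_measure X).

Definition KA (x s : borel X) : R := - 2^-1 * (mdist (x : X) (s : X)) ^+ 2.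

Definition KB (x s : borel X) : R :=
  KA x s - (\int[mu]_w KA w s) - (\int[mu]_z KA x z)
  + \int[mu]_w (\int[mu]_z KA w z).

Definition TKB (phi : borel X -> R) : borel X -> R :=
  fun x => \int[mu]_s (KB x s * phi s).

Definition cTKB (phi : borel X -> R[i]) : borel X -> R[i] :=
  fun x => cintegral mu (fun s => (KB x s)%:C%C * phi s).

(* [lam] lists eigenvalues in nonincreasing order, with orthonormal real
   eigenfunctions [phi]. The last clause says that no positive eigenvalue is
   missing and that each occurs with its full multiplicity: its eigenspace is
   spanned by the listed eigenfunctions. When there are infinitely many
   positive eigenvalues, as for the circle, a nonincreasing sequence indexed by
   [nat] can list only those. *)
Definition mds_eigensystem (lam : nat -> R) (phi : nat -> borel X -> R) :=
  [/\ nonincreasing_seq lam,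
      rorthonormal mu phi,
      forall i, reigenfunction mu TKB (lam i) (phi i)
    & forall (l : R) (f : borel X -> R), 0 < l -> reigenfunction mu TKB l f ->
        exists (n : nat) (c : nat -> R),
          f = (fun x => \sum_(i < n | lam i == l) c i * phi i x) %[ae mu]].

Definition mds_embedding (lam : nat -> R) (phi : nat -> borel X -> R)
    (x : borel X) : nat -> R :=
  fun i => Num.sqrt (Num.max (lam i) 0) * phi i x.

End MDS.

Arguments TKB {R} X.
Arguments cTKB {R} X.
Arguments mds_eigensystem {R} X.
Arguments mds_embedding {R} X.

(** * The circle R / 2 pi Z *)

Section period.
Context {R : realType}.

Definition period : {pred R} :=
  fun x => `[< exists k : int, x = k%:~R * (2 * pi) >].

Lemma periodP (x : R) :
  reflect (exists k : int, x = k%:~R * (2 * pi)) (x \in period).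
Proof. exact: asboolP. Qed.

Fact period_zmod_closed : zmod_closed period.
Proof.
split; first by apply/periodP; exists 0; rewrite mul0r.
move=> _ _ /periodP[k ->] /periodP[l ->]; apply/periodP.
by exists (k - l); rewrite rmorphB mulrBl.
Qed.

HB.instance Definition _ := GRing.isZmodClosed.Build R period
  period_zmod_closed.

End period.

Definition circle (R : realType) : Type := Quotient.quot (@period R).

HB.instance Definition _ (R : realType) := Choice.on (circle R).

Section circle_metric.
Context {R : realType}.

Definition toC (t : R) : circle R := (\pi_(Quotient.quot (@period R)) t)%qT.

Lemma toC_eq (s t : R) : toC s = toC t <-> s - t \in period.
Proof.
by rewrite Quotient.idealrBE; split=> [/eqP|/eqP].
Qed.

Lemma toC_surj (x : circle R) : exists t, toC t = x.
Proof. by exists (repr (x : Quotient.quot (@period R))); rewrite /toC reprK. Qed.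

(* Length of the shortest arc joining [x] and [y]: least difference between
   angles representing them. *)
Definition circle_dist (x y : circle R) : R :=
  inf [set `|s - t| | s in toC @^-1` [set x] & t in toC @^-1` [set y]].


Lemma twopi_gt0 : 0 < 2 * pi :> R. Proof. by rewrite mulr_gt0// pi_gt0. Qed.

#[local] Hint Resolve twopi_gt0 : core.

Lemma circle_dist_le (s t : R) : circle_dist (toC s) (toC t) <= `|s - t|.
Proof.
apply: ge_inf; first by exists 0 => _ [u _ [v _ <-]].
by exists s => //; exists t.
Qed.

Lemma near_period (r : R) : exists k : int, `|r - k%:~R * (2 * pi)| <= pi.
Proof.
have := @floor_itv R ((r + pi) / (2 * pi)); rewrite ler_pdivlMr// ltr_pdivrMr//.
set k := Num.floor _ => /andP[h1 h2]; exists k.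
move: h2; rewrite intrD mulrDl mul1r => h2.
rewrite ler_norml; move: h1 h2; move: (k%:~R * _) => a h1 h2.
by apply/andP; split; lra.
Qed.

(* Below the antipodal distance, the arc length is the difference of angles. *)
Lemma circle_distE (s t : R) : `|s - t| <= pi ->
  circle_dist (toC s) (toC t) = `|s - t|.
Proof.
move=> st; apply/eqP; rewrite eq_le circle_dist_le/=.
apply: lb_le_inf; first by exists `|s - t|; exists s => //; exists t.
move=> _ [u /toC_eq us [v /toC_eq vt <-]].
have /periodP[k uvst] : (u - v) - (s - t) \in period.
  have -> : (u - v) - (s - t) = (u - s) - (v - t) by ring.
  exact: rpredB us vt.
have -> : u - v = (s - t) + k%:~R * (2 * pi) by rewrite -uvst; ring.
move: (s - t) st => r rpi.
have [->|k0] := eqVneq k 0; first by rewrite mul0r addr0.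
have k1 : 1 <= `|k%:~R| :> R.
  by rewrite -intr_norm -[1]/(1%:~R) ler_int -gtz0_ge1 normr_gt0.
have := ler_normB (r + k%:~R * (2 * pi)) r; rewrite addrAC subrr add0r normrM.
rewrite (gtr0_norm twopi_gt0).
have : 2 * pi <= `|k%:~R| * (2 * pi) :> R by rewrite ler_peMl// ltW.
by move: (`|_| * (2 * pi)) => a h1 h2; lra.
Qed.

Let circle_rep (t : R) (y : circle R) :
  exists2 u, toC u = y & `|t - u| <= pi.
Proof.
have [v <-] := toC_surj y; have [k hk] := near_period (t - v).
exists (v + k%:~R * (2 * pi)); last by rewrite opprD addrA.
by apply/toC_eq; rewrite addrAC subrr add0r; apply/periodP; exists k.
Qed.

Let circle_distxx (x : circle R) : circle_dist x x = 0.
Proof.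
by have [t <-] := toC_surj x; rewrite circle_distE subrr normr0// pi_ge0.
Qed.

Let circle_dist_positivity (x y : circle R) : circle_dist x y = 0 -> x = y.
Proof.
have [t <-] := toC_surj x; have [u <- tu] := circle_rep t y.
by rewrite circle_distE// => /normr0_eq0/eqP; rewrite subr_eq0 => /eqP ->.
Qed.

Let circle_dist_sym (x y : circle R) : circle_dist x y = circle_dist y x.
Proof.
have [t <-] := toC_surj x; have [u <- tu] := circle_rep t y.
by rewrite circle_distE// circle_distE distrC.
Qed.

Let circle_dist_triangle (y x z : circle R) :
  circle_dist x z <= circle_dist x y + circle_dist y z.
Proof.
have [t <-] := toC_surj y; have [u <- tu] := circle_rep t x.
have [v <- tv] := circle_rep t z.
rewrite (circle_dist_sym (toC u) (toC t)) !(@circle_distE t)// (distrC t u).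
apply: le_trans (circle_dist_le _ _) _.
exact: ler_distD.
Qed.

HB.instance Definition _ := @isMetric.Build R (circle R) circle_dist
  circle_distxx circle_dist_positivity circle_dist_sym circle_dist_triangle.

HB.instance Definition _ := isPointed.Build (circle R) (toC 0).

Lemma continuous_toC : continuous toC.
Proof.
move=> t; apply/cvg_ballP => e e0; near=> s.
rewrite ballEmdist/=; apply: le_lt_trans (circle_dist_le _ _) _.
by near: s; exact: (nbhsx_ballx t e e0).
Unshelve. all: by end_near. Qed.

(* [toC] between the types carrying the Borel sigma-algebras. *)
Definition toC_borel (t : measurableTypeR R) : borel (circle R) := toC t.

Lemma measurable_toC : measurable_fun setT toC_borel.
Proof.
apply: (@measurability _ _ _ _ setT toC_borel (@open (circle R))) => //.
move=> _ [A oA <-]; rewrite setTI; apply: (@open_measurable R).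
by apply: open_comp => // t _; exact: continuous_toC.
Qed.

HB.instance Definition _ := isMeasurableFun.Build _ _ _ _ toC_borel
  measurable_toC.

(* Image of the normalized Lebesgue measure on [0, 2 pi]. *)
Definition circle_measure : probability (borel (circle R)) R :=
  distribution (uniform_prob twopi_gt0) toC_borel.

Lemma compact_circle : compact [set: circle R].
Proof.
have -> : [set: circle R] = toC @` `[- pi, pi].
  apply/esym; rewrite -subTset => x _.
  have [u ux] := circle_rep 0 x; rewrite sub0r normrN ler_norml => u_pi.
  by exists u => //=; rewrite in_itv.
apply: continuous_compact (@segment_compact _ _ _).
by apply: continuous_subspaceT; exact: continuous_toC.
Qed.

Definition mm_circle : mmSpace R := MMSpace compact_circle circle_measure.

End circle_metric.

Arguments circle_measure : clear implicits.
Arguments mm_circle : clear implicits.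

Section circle_functions.
Context {R : realType}.

Definition angle (x : circle R) : R := repr (x : Quotient.quot (@period R)).

Lemma angleK (x : circle R) : toC (angle x) = x.
Proof. by rewrite /toC /angle reprK. Qed.

Lemma cosDperiod (t : R) (k : int) : cos (t + k%:~R * (2 * pi)) = cos t.
Proof.
have cosDn (u : R) (n : nat) : cos (u + n%:R * (2 * pi)) = cos u.
  by rewrite !mulr_natl periodicn//; exact: cosD2pi.
case: k => n; first exact: cosDn.
by rewrite -(cosDn _ n.+1) NegzE rmorphN/= mulNr subrK.
Qed.

Lemma sinDperiod (t : R) (k : int) : sin (t + k%:~R * (2 * pi)) = sin t.
Proof.
have := cosDperiod (t - pi / 2) k.
by rewrite addrAC cosBpihalf cosBpihalf.
Qed.

Lemma angle_toC (t : R) : exists k : int, angle (toC t) = t + k%:~R * (2 * pi).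
Proof.
have /toC_eq/periodP[k kE] := angleK (toC t).
by exists k; rewrite -kE addrC subrK.
Qed.

(* The functions e^(ikx), sqrt 2 cos kx and sqrt 2 sin kx on the circle; the
   lemmas [circle_*E] show that the choice of the angle is immaterial. *)
Definition circle_exp (k : int) (x : circle R) : R[i] :=
  (cos (k%:~R * angle x) +i* sin (k%:~R * angle x))%C.

Definition circle_cos (n : nat) (x : circle R) : R :=
  Num.sqrt 2 * cos (n%:R * angle x).

Definition circle_sin (n : nat) (x : circle R) : R :=
  Num.sqrt 2 * sin (n%:R * angle x).

Lemma circle_expE (k : int) (t : R) :
  circle_exp k (toC t) = (cos (k%:~R * t) +i* sin (k%:~R * t))%C.
Proof.
have [l lE] := angle_toC t.
by rewrite /circle_exp lE mulrDr mulrA -intrM cosDperiod sinDperiod.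
Qed.

Lemma circle_cosE (n : nat) (t : R) :
  circle_cos n (toC t) = Num.sqrt 2 * cos (n%:R * t).
Proof.
have [l lE] := angle_toC t.
by rewrite /circle_cos lE mulrDr mulrA -[n%:R]/(n%:~R) -intrM cosDperiod.
Qed.

Lemma circle_sinE (n : nat) (t : R) :
  circle_sin n (toC t) = Num.sqrt 2 * sin (n%:R * t).
Proof.
have [l lE] := angle_toC t.
by rewrite /circle_sin lE mulrDr mulrA -[n%:R]/(n%:~R) -intrM sinDperiod.
Qed.

Definition circle_lambda (k : int) : R := (-1) ^ (k + 1) / k%:~R ^+ 2.

(* Frequencies 1, 1, 3, 3, 5, 5, ... of the coordinates 0, 1, 2, ... *)
Definition freq (n : nat) : nat := (n./2.*2).+1.

Definition gamma (t : R) : nat -> R := fun n =>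
  Num.sqrt 2 * ((freq n)%:R^-1 *
    (if odd n then sin ((freq n)%:R * t) else cos ((freq n)%:R * t))).

Definition circle_mds_lambda (n : nat) : R := circle_lambda (freq n).

Definition circle_mds_phi (n : nat) : circle R -> R :=
  if odd n then circle_sin (freq n) else circle_cos (freq n).

End circle_functions.

(* Main.v *)
Require Import Defs.
From mathcomp Require Import all_boot all_order all_algebra.
From mathcomp Require Import all_classical all_reals all_analysis.
From mathcomp Require Import measurable_realfun complex ring lra.

(** On the circle the kernel is [K_B(x, s) = pi^2/6 - d(x, s)^2/2], a function
   of the difference of angles; integrating by parts twice over an interval
   of length [2 pi] centred at [x] shows that every [cos (k s + a)] is an
   eigenfunction with eigenvalue [(-1)^(k+1)/k^2].

   Trigonometric polynomials form an algebra of bounded functions whose sets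
   [p < 1/2] generate the Borel sets. A measure-theoretic form of the
   Stone-Weierstrass theorem makes them dense in [L^2]: indicators of such
   sets are bounded limits of polynomials in [p], a Dynkin argument reaches
   all measurable sets, and dominated convergence reaches [L^2]. Hence the
   exponentials form a Hilbert basis, and since an eigenfunction for [l] is
   orthogonal to all modes with another eigenvalue, the listed
   eigenfunctions span each eigenspace with [l > 0].

   The norm of the embedding comes from [cos^2 + sin^2 = 1] and
   [sum 1/(2j+1)^2 = pi^2/8]. *)

Set Implicit Arguments.
Unset Strict Implicit.
Unset Printing Implicit Defensive.

Import Order.TTheory GRing.Theory Num.Theory.
Import numFieldNormedType.Exports.

Local Open Scope classical_set_scope.
Local Open Scope ring_scope.

(** * Density of subalgebras in L^2 *)

(** Computations on the circle are carried out on the real line through [toC]. A period may start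
    anywhere, so the window of integration can be centred at the point under study, where the arc
    length is [|t - s|] and the kernel is a quadratic polynomial. By rotation invariance all means
    of [K_A] coincide with the mean of [- s^2 / 2] over [[- pi, pi]], which is the origin of the
    constant [pi^2 / 6].

    The obstacle is that [mds_eigensystem] speaks of every eigenfunction in L^2, and its equation
    holds only almost everywhere. As the kernel is bounded, the operator sends functions that are
    small in L^2 to uniformly small ones; so trigonometric polynomials, where all is explicit,
    control arbitrary functions. Even [k] give negative eigenvalues, which is why only odd
    frequencies enter the embedding. *)

Section L2_density.
Import HBNNSimple.
Context {d : measure_display} {T : measurableType d} {R : realType}.
Variable mu : probability T R.

Lemma Lfun2P (f : T -> R) : f \in Lfun mu 2%:E <->
  measurable_fun setT f /\ mu.-integrable setT (EFin \o (fun x => f x ^+ 2)).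
Proof.
split=> [fL|[mf fi]].
  split; last exact: Lfun2_integrable_sqr.
  by move: fL; rewrite inE => /andP[/[!inE]].
rewrite inE; apply/andP; split; rewrite inE//=.
rewrite /finite_norm unlock poweR_lty//.
have /integrableP[_] := fi; apply: le_lt_trans.
rewrite le_eqVlt; apply/orP; left; apply/eqP; apply: eq_integral => x _ /=.
by rewrite powR_mulrn// normrX.
Qed.

Definition bounded_measurable (f : T -> R) :=
  measurable_fun setT f /\ exists M, forall x, `|f x| <= M.

Lemma bounded_measurable_integrable f : bounded_measurable f ->
  mu.-integrable setT (EFin \o f).
Proof.
move=> [mf [M fM]]; apply: measurable_bounded_integrable => //.
  by rewrite -ge0_fin_numE// fin_num_measure.
exists M; split; first exact: num_real.
by move=> N MN x _; apply: le_trans (fM x) (ltW MN).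
Qed.

Lemma bounded_measurableM f g : bounded_measurable f -> bounded_measurable g ->
  bounded_measurable (fun x => f x * g x).
Proof.
move=> [mf [M fM]] [mg [N gN]]; split; first exact: measurable_funM.
by exists (M * N) => x; rewrite normrM ler_pM.
Qed.

Lemma bounded_measurable_Lfun2 f : bounded_measurable f -> f \in Lfun mu 2%:E.
Proof.
move=> bf; apply/Lfun2P; split; first by case: bf.
exact: bounded_measurable_integrable (bounded_measurableM bf bf).
Qed.

Lemma Lfun2M_integrable f g : f \in Lfun mu 2%:E -> g \in Lfun mu 2%:E ->
  mu.-integrable setT (EFin \o (fun x => f x * g x)).
Proof. by move=> fL gL; apply/Lfun1_integrable; exact: Lfun2_mul_Lfun1. Qed.

Lemma Lfun2D (f g : T -> R) : f \in Lfun mu 2%:E -> g \in Lfun mu 2%:E ->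
  (fun x => f x + g x) \in Lfun mu 2%:E.
Proof.
by move=> fL gL; apply: (Lfun_addr_closed mu (lee1n 2)).2.
Qed.

Lemma Lfun2Z (f : T -> R) (c : R) : f \in Lfun mu 2%:E ->
  (fun x => c * f x) \in Lfun mu 2%:E.
Proof.
move=> fL; have := Lfun_scale c (ler1n R 2) fL.
by under [X in X \in _ -> _]eq_fun do rewrite /= mulrC.
Qed.

Lemma Lfun2B (f g : T -> R) : f \in Lfun mu 2%:E -> g \in Lfun mu 2%:E ->
  (fun x => f x - g x) \in Lfun mu 2%:E.
Proof.
move=> fL gL; have := Lfun2D fL (Lfun2Z (-1) gL).
by under [X in X \in _ -> _]eq_fun do rewrite mulN1r.
Qed.

Lemma Lfun2_measurable (f : T -> R) : f \in Lfun mu 2%:E ->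
  measurable_fun setT f.
Proof. by case/Lfun2P. Qed.

Lemma Lfun2_le (f g : T -> R) : measurable_fun setT f ->
  (forall x, `|f x| <= `|g x|) -> g \in Lfun mu 2%:E -> f \in Lfun mu 2%:E.
Proof.
move=> mf fg /Lfun2P[mg gi]; apply/Lfun2P; split => //.
apply: le_integrable gi => //.
  by apply/measurable_EFinP; exact: measurable_funX.
by move=> x _ /=; rewrite lee_fin !normrX lerXn2r ?nnegrE.
Qed.

Local Notation sqdist f g := (\int[mu]_x ((f x - g x) ^+ 2)%:E)%E.

(** The pointwise bound [(a + b)^2 <= 2 a^2 + 2 b^2] stands in for the triangle inequality, so no
    roots are taken. Its factors 2 explain the errors [e / 4] below. *)
Lemma sqdist_triangle (f g h : T -> R) : measurable_fun setT f ->
  measurable_fun setT g -> measurable_fun setT h ->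
  (sqdist f h <= 2%:E * sqdist f g + 2%:E * sqdist g h)%E.
Proof.
move=> mf mg mh.
have mB (u v : T -> R) : measurable_fun setT u -> measurable_fun setT v ->
    measurable_fun setT (fun x => ((u x - v x) ^+ 2)%:E).
  move=> mu_ mv; apply/measurable_EFinP/measurable_funX.
  exact: measurable_funB.
rewrite -!ge0_integralZl//; first last.
- by move=> x _; rewrite lee_fin sqr_ge0.
- exact: mB.
- by move=> x _; rewrite lee_fin sqr_ge0.
- exact: mB.
rewrite -ge0_integralD//; first last.
- by apply: measurable_funeM; exact: mB.
- by move=> x _; rewrite mule_ge0// lee_fin sqr_ge0.
- by apply: measurable_funeM; exact: mB.
- by move=> x _; rewrite mule_ge0// lee_fin sqr_ge0.
apply: ge0_le_integral => //.
- by move=> x _; rewrite lee_fin sqr_ge0.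
- exact: mB.
- by apply: emeasurable_funD; apply: measurable_funeM; exact: mB.
- move=> x _; rewrite -!EFinM -EFinD lee_fin.
  have -> : f x - h x = (f x - g x) + (g x - h x) by ring.
  move: (f x - g x) (g x - h x) => a b.
  have := sqr_ge0 (a - b); nra.
Qed.

Lemma cvg_sqdist (f_ : nat -> T -> R) (f g : T -> R) :
  (forall n, measurable_fun setT (f_ n)) ->
  (forall x, f_ n x @[n --> \oo] --> f x) ->
  (forall n x, `|f_ n x| <= g x) -> g \in Lfun mu 2%:E ->
  f \in Lfun mu 2%:E /\ (sqdist f (f_ n) @[n --> \oo] --> 0)%E.
Proof.
move=> mf_ f_f f_g gL.
have mf : measurable_fun setT f.
  by apply: (measurable_fun_cvg (h := f_)) => // x _; exact: f_f.
have fg x : `|f x| <= g x.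
  have f_fx : `|f_ n x| @[n --> \oo] --> `|f x|.
    exact: (cvg_norm (f_f x)).
  rewrite -(cvg_lim _ f_fx)//; apply: limr_le.
    by apply/cvg_ex; eexists; exact: f_fx.
  by apply: nearW => n; exact: f_g.
have fL : f \in Lfun mu 2%:E.
  apply: Lfun2_le gL => // x.
  by rewrite (ger0_norm (le_trans _ (fg x))).
split=> //.
have /Lfun2P[mg gi] := gL.
(* Both [f] and [f_ n] are bounded by [g], hence [(f - f_ n)^2 <= (2 g)^2]. *)
have := @dominated_convergence _ _ _ mu setT measurableT
   (fun n x => ((f x - f_ n x) ^+ 2)%:E) (fun=> 0%E)
   (fun x => (4 * g x ^+ 2)%:E).
case.
- move=> n; apply/measurable_EFinP/measurable_funX.
  exact: measurable_funB.
- exact: measurable_cst.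
- apply/aeW => x _; apply/fine_cvgP; split; first exact: nearW.
  have h : f x - f_ n x @[n --> \oo] --> f x - f x.
    exact: cvgB (cvg_cst _) (f_f x).
  have := cvgM h h; rewrite subrr mulr0.
  exact.
- rewrite (_ : (fun x => _) = (fun x => 4%:E * (g x ^+ 2)%:E)%E)//.
  exact: integrableZl.
- apply/aeW => x n _; rewrite gee0_abs ?lee_fin ?sqr_ge0//.
  have -> : 4 * g x ^+ 2 = (2 * g x) ^+ 2 by ring.
  have := fg x; have := f_g n x; rewrite !ler_norml => /andP[h1 h2] /andP[h3 h4].
  by nra.
by move=> _ _; rewrite integral0.
Qed.

Lemma sqdist_fin_num (f g : T -> R) : f \in Lfun mu 2%:E -> g \in Lfun mu 2%:E ->
  sqdist f g \is a fin_num.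
Proof.
move=> fL gL; apply: integrable_fin_num => //.
by have /Lfun2P[] := Lfun2B fL gL.
Qed.

Lemma bernoulli_ge (x : R) n : 0 <= x <= 1 -> 1 - n%:R * x <= (1 - x) ^+ n.
Proof.
move=> /andP[x0 x1]; elim: n => [|n IH]; first by rewrite mul0r subr0 expr0.
rewrite exprS; apply: (@le_trans _ _ ((1 - x) * (1 - n%:R * x))); last first.
  by apply: ler_wpM2l => //; rewrite subr_ge0.
have n0 : 0 <= n%:R :> R by [].
by rewrite -natr1; nra.
Qed.

(** The left side decreases with [n]: each step subtracts [(n + 1) x^2 (1 - x)^n]. *)
Lemma bernoulli_le (x : R) n : 0 <= x <= 1 ->
  (1 - x) ^+ n * (1 + n%:R * x) <= 1.
Proof.
move=> /andP[x0 x1]; elim: n => [|n IH]; first by rewrite expr0 mul0r addr0 mul1r.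
apply: le_trans IH; rewrite exprS.
have h : 0 <= (1 - x) ^+ n by rewrite exprn_ge0// subr_ge0.
have -> : (1 - x) * (1 - x) ^+ n * (1 + n.+1%:R * x) =
    (1 - x) ^+ n * (1 + n%:R * x) - n.+1%:R * (x ^+ 2 * (1 - x) ^+ n).
  by rewrite -natr1; ring.
by rewrite gerBl !mulr_ge0// sqr_ge0.
Qed.

Section subalgebra.
Variable P : (T -> R) -> Prop.
Hypothesis P1 : P (fun=> 1).
Hypothesis PD : forall p q, P p -> P q -> P (fun x => p x + q x).
Hypothesis PM : forall p q, P p -> P q -> P (fun x => p x * q x).
Hypothesis PZ : forall c p, P p -> P (fun x => c * p x).
Hypothesis Pb : forall p, P p -> bounded_measurable p.

Let PX p n : P p -> P (fun x => p x ^+ n).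
Proof.
move=> Pp; elim: n => [|n IH]; first exact: P1.
by under eq_fun do rewrite exprS; exact: PM.
Qed.

Let PC p : P p -> P (fun x => 1 - p x).
Proof.
move=> Pp; have := PD P1 (PZ (-1) Pp).
by under eq_fun do rewrite mulN1r.
Qed.

Let closure f := f \in Lfun mu 2%:E /\
  forall e : R, 0 < e -> exists2 p, P p & (sqdist f p < e%:E)%E.

Let closure_sub p : P p -> closure p.
Proof.
move=> Pp; split; first exact/bounded_measurable_Lfun2/Pb.
move=> e e0; exists p => //.
rewrite integral0_eq ?lte_fin// => x _.
by rewrite subrr expr0n.
Qed.

(** Dominated convergence brings some [f_ n] close to [f], then [p] is taken close to [f_ n]. All
    later limits (powers to indicators, disjoint unions, simple functions to nonnegative ones) pass
    through this. *)
Let closure_lim (f_ : nat -> T -> R) (f g : T -> R) :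
  (forall n, closure (f_ n)) ->
  (forall x, f_ n x @[n --> \oo] --> f x) ->
  (forall n x, `|f_ n x| <= g x) -> g \in Lfun mu 2%:E -> closure f.
Proof.
move=> cf_ f_f f_g gL.
have [fL d0] := cvg_sqdist (fun n => Lfun2_measurable (cf_ n).1) f_f f_g gL.
split=> // e e0.
have e4 : 0 < e / 4 by rewrite divr_gt0.
have [n fn] : exists n, (sqdist f (f_ n) < (e / 4)%:E)%E.
  move/fine_cvgP : d0 => [dfin /cvgrPdist_lt /(_ _ e4) dlt].
  near \oo => n; exists n.
  have hf : sqdist f (f_ n) \is a fin_num by near: n.
  rewrite -(fineK hf) lte_fin.
  apply: le_lt_trans (ler_norm _) _.
  by rewrite -normrN -sub0r; near: n.
have [p Pp fnp] := (cf_ n).2 _ e4.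
exists p => //.
have mp : measurable_fun setT p by case: (Pb Pp).
apply: le_lt_trans (sqdist_triangle (Lfun2_measurable fL)
  (Lfun2_measurable (cf_ n).1) mp) _.
have -> : e%:E = (2%:E * (e / 4)%:E + 2%:E * (e / 4)%:E)%E.
  by rewrite -!EFinM -EFinD; congr EFin; field.
by rewrite lteD// lte_pmul2l.
Unshelve. all: by end_near. Qed.

Let closureD f g : closure f -> closure g -> closure (fun x => f x + g x).
Proof.
move=> [fL fc] [gL gc]; split; first exact: Lfun2D.
move=> e e0.
have e4 : 0 < e / 4 by rewrite divr_gt0.
have [p Pp fp] := fc _ e4; have [q Pq gq] := gc _ e4.
have [mp _] := Pb Pp; have [mq _] := Pb Pq.
have mf := Lfun2_measurable fL; have mg := Lfun2_measurable gL.
exists (fun x => p x + q x); first exact: PD.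
apply: le_lt_trans (sqdist_triangle (g := fun x => p x + g x) _ _ _) _.
- exact: measurable_funD.
- exact: measurable_funD.
- exact: measurable_funD.
have -> : e%:E = (2%:E * (e / 4)%:E + 2%:E * (e / 4)%:E)%E.
  by rewrite -!EFinM -EFinD; congr EFin; field.
rewrite lteD// lte_pmul2l//.
  by under eq_integral do rewrite opprD addrACA subrr addr0.
by under eq_integral do rewrite opprD addrACA subrr add0r.
Qed.

Let closureZ c f : closure f -> closure (fun x => c * f x).
Proof.
move=> [fL fc]; split; first exact: Lfun2Z.
move=> e e0.
(* The added 1 keeps the divisor positive when [c = 0]. *)
have c1 : 0 < c ^+ 2 + 1 by rewrite ltr_wpDl// sqr_ge0.
have ec : 0 < e / (c ^+ 2 + 1) by rewrite divr_gt0.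
have [p Pp fp] := fc _ ec; exists (fun x => c * p x); first exact: PZ.
have [mp _] := Pb Pp; have mf := Lfun2_measurable fL.
under eq_integral do rewrite -mulrBr exprMn EFinM.
rewrite ge0_integralZl//; last 3 first.
- by apply/measurable_EFinP/measurable_funX/measurable_funB.
- by move=> x _; rewrite lee_fin sqr_ge0.
- by rewrite lee_fin sqr_ge0.
apply: (@le_lt_trans _ _ ((c ^+ 2 + 1)%:E * sqdist f p)%E).
  apply: lee_wpmul2r; last by rewrite lee_fin lerDl.
  by apply: integral_ge0 => x _; rewrite lee_fin sqr_ge0.
have -> : e%:E = ((c ^+ 2 + 1)%:E * (e / (c ^+ 2 + 1))%:E)%E.
  by rewrite -EFinM; congr EFin; field; rewrite gt_eqF.
by rewrite lte_pmul2l// ?lte_fin.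
Qed.

Let Lfun2_cst (c : R) : (fun=> c) \in Lfun mu 2%:E.
Proof.
apply: bounded_measurable_Lfun2; split; first exact: measurable_cst.
by exists `|c|.
Qed.

(** The range [[0, 1]] makes Bernoulli's inequality applicable, and the level [1/2] is where
    [4^n q^(2n) = (2 q)^(2n)] changes from decay to growth. *)
Definition threshold_sets :=
  [set A | exists p, [/\ P p, forall x, 0 <= p x <= 1 &
     A = [set x | p x < 2^-1]]].

(* Unlike the threshold sets, these are closed under intersection, as the
   approximations can be multiplied. *)
Let approx_sets : set (set T) :=
  [set A | exists p_ : nat -> T -> R, [/\ forall n, P (p_ n),
     forall n x, 0 <= p_ n x <= 1 & forall x, p_ n x @[n --> \oo] --> (\1_A x : R)]].

Let approx_setsI : setI_closed approx_sets.
Proof.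
move=> A B [p [Pp p01 pA]] [q [Pq q01 qB]].
exists (fun n x => p n x * q n x); split.
- by move=> n; exact: PM.
- move=> n x; have /andP[p0 p1] := p01 n x; have /andP[q0 q1] := q01 n x.
  by rewrite mulr_ge0//= mulr_ile1.
- by move=> x; rewrite indicI; exact: cvgM.
Qed.

(* By Bernoulli's inequality [(1 - q ^ (2 n)) ^ (n 4 ^ n)] tends to [1] where
   [q < 1/2] and to [0] where [q >= 1/2]; the factor [n] settles [q = 1/2]. *)
Let sub_threshold_approx : threshold_sets `<=` approx_sets.
Proof.
move=> _ [q [Pq q01 ->]].
exists (fun n x => (1 - q x ^+ (2 * n)) ^+ (n * 4 ^ n)); split.
- by move=> n; apply: PX; apply: PC; exact: PX.
- move=> n x; have /andP[q0 q1] := q01 x.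
  have h0 : 0 <= q x ^+ (2 * n) by rewrite exprn_ge0.
  have h1 : q x ^+ (2 * n) <= 1 by rewrite exprn_ile1.
  by rewrite exprn_ge0 ?subr_ge0//= exprn_ile1// ?subr_ge0// gerBl.
move=> x; have /andP[q0 q1] := q01 x.
have qn01 n : 0 <= q x ^+ (2 * n) <= 1 by rewrite exprn_ge0// exprn_ile1.
(* For [q < 1/2] the factor [n (2 q)^n] stays bounded, and the remaining [(2 q)^n] tends to 0. *)
have NE n : (n * 4 ^ n)%:R * q x ^+ (2 * n) = n%:R * (2 * q x) ^+ n * (2 * q x) ^+ n.
  rewrite -mulrA -exprMn exprM natrM natrX -mulrA -exprMn.
  by congr (_ * _ ^+ _); ring.
have [xq|xq] := ltP (q x) 2^-1.
  rewrite indicE mem_set//=.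
  have w1 : `|2 * q x| < 1 by rewrite ger0_norm; lra.
  have z0 : 0 < 1 - 2 * q x by lra.
  apply: (@squeeze_cvgr _ _ _ _
    (fun n => 1 - (1 - 2 * q x)^-1 * (2 * q x) ^+ n) (fun=> 1)).
  - apply: nearW => n; have /andP[qn0 qn1] := qn01 n.
    rewrite exprn_ile1 ?subr_ge0 ?gerBl ?andbT//.
    apply: le_trans (bernoulli_ge _ (qn01 n)).
    rewrite lerD2l lerN2 NE ler_wpM2r// ?exprn_ge0 ?mulr_ge0//.
    (* Applied to [1 - 2 q], this gives [n (2 q)^n <= 1 / (1 - 2 q)]. *)
    have /(@bernoulli_le _ n) : 0 <= 1 - 2 * q x <= 1 by lra.
    rewrite subKr; set y := _ ^+ n => hy.
    have y0 : 0 <= y by rewrite exprn_ge0// mulr_ge0.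
    rewrite -[leRHS]mul1r ler_pdivlMr//.
    apply: le_trans hy.
    suff -> : y * (1 + n%:R * (1 - 2 * q x)) = y + n%:R * y * (1 - 2 * q x).
      by rewrite lerDr.
    by ring.
  - rewrite [X in _ --> X](_ : _ = 1 - (1 - 2 * q x)^-1 * 0); last first.
      by rewrite mulr0 subr0.
    apply: cvgB; first exact: cvg_cst.
    by apply: cvgMr; exact: cvg_expr.
  - exact: cvg_cst.
rewrite indicE memNset/=; last by rewrite ltNge xq.
(* Here [2 q >= 1], so exponent times [q^(2n)] is at least [n], and [bernoulli_le] bounds the power
   by [1 / (n + 1)]. *)
apply: (@squeeze_cvgr _ _ _ _ (fun=> 0) (fun n => n.+1%:R^-1)).
- apply: nearW => n; rewrite exprn_ge0 ?subr_ge0/=; last by case/andP: (qn01 n).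
  rewrite -[leRHS]mul1r ler_pdivlMr//.
  apply: le_trans (bernoulli_le (n * 4 ^ n) (qn01 n)).
  apply: ler_wpM2l.
    by rewrite exprn_ge0 ?subr_ge0//; case/andP: (qn01 n).
  rewrite NE -natr1 addrC lerD2l -mulrA ler_peMr// mulr_ege1// exprn_ege1//; lra.
- exact: cvg_cst.
- exact: cvg_harmonic.
Qed.

Let approx_sets_closure A : approx_sets A -> closure \1_A.
Proof.
move=> [p [Pp p01 pA]].
apply: (closure_lim (f_ := p) (g := fun=> 1)) => //.
- by move=> n; exact: closure_sub.
- by move=> n x; have /andP[p0 p1] := p01 n x; rewrite ger0_norm.
Qed.

Hypothesis P_generates : @measurable _ T = <<s threshold_sets >>.

(** The indicator is a limit of members of [P], hence measurable, and [A] is its preimage of 1. *)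
Let approx_sets_measurable A : approx_sets A -> measurable A.
Proof.
move=> /approx_sets_closure[/Lfun2_measurable mA _].
rewrite -[A]setTI (_ : A = \1_A @^-1` [set 1 : R]); first exact: mA.
apply/seteqP; split=> x /=; rewrite indicE; first by move=> /mem_set ->.
by case: (boolP (x \in A)) => [/set_mem//|_ /eqP]; rewrite eq_sym oner_eq0.
Qed.

Let approx_sets_generate : @measurable _ T = <<s approx_sets >>.
Proof.
apply/seteqP; split.
  by rewrite P_generates; apply: sub_sigma_algebra2; exact: sub_threshold_approx.
apply: smallest_sub; last exact: approx_sets_measurable.
by split => [|A mA|F mF]; [exact: measurable0|rewrite setTD; exact: measurableC|
  exact: bigcup_measurable].
Qed.

Let closure_indic A : measurable A -> closure \1_A.
Proof.
rewrite {1}approx_sets_generate.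
apply: (dynkin_induction (P := fun A => closure \1_A)).
- exact: approx_sets_generate.
- exact: approx_setsI.
- by rewrite indicT; exact: closure_sub.
- exact: approx_sets_closure.
- move=> S mS cS; rewrite (_ : \1_(~` S) = fun x => 1 + -1 * \1_S x).
    by apply: closureD; [exact: closure_sub|exact: closureZ].
  apply/funext => x; rewrite !indicE in_setC.
  by case: (x \in S) => /=; rewrite ?mulr1 ?mulr0 ?subrr ?addr0.
move=> F mF tF cF.
(* By disjointness the partial sums at [x] jump once from 0 to 1, after the index of the set
   containing [x]. Hence they are eventually constant and bounded by 1. *)
have sumE x k n : F k x -> \sum_(i < n) (\1_(F i) x : R) = (k < n)%:R.
  move=> Fkx; elim: n => [|n IH]; first by rewrite big_ord0.
  rewrite big_ord_recr/= IH indicE ltnS (leq_eqVlt k n).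
  have -> : (x \in F n) = (k == n).
    apply/idP/eqP => [|<-]; rewrite inE// => Fnx.
    by apply: tF => //; exists x.
  by case: eqVneq => [->|_]; rewrite ?ltnn ?add0r ?addr0//= addr0.
have sum0 x n : ~ (\bigcup_k F k) x -> \sum_(i < n) (\1_(F i) x : R) = 0.
  move=> nFx; rewrite big1// => i _; rewrite indicE memNset// => Fix.
  by apply: nFx; exists i.
apply: (closure_lim (f_ := fun n x => \sum_(i < n) \1_(F i) x) (g := fun=> 1)) => //.
- elim=> [|n IH].
    under eq_fun do rewrite big_ord0.
    by have := closureZ 0 (closure_sub P1); under eq_fun do rewrite mul0r.
  by under eq_fun do rewrite big_ord_recr; exact: closureD.
- move=> x; rewrite indicE; have [Fx|nFx] := pselect ((\bigcup_k F k) x).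
    rewrite mem_set//; case: Fx => k _ Fkx.
    under eq_fun do rewrite (sumE _ _ _ Fkx).
    by apply: cvg_near_cst; exists k.+1 => // n /= kn; rewrite kn.
  rewrite memNset//; under eq_fun do rewrite (sum0 _ _ nFx).
  exact: cvg_cst.
- move=> n x; have [Fx|nFx] := pselect ((\bigcup_k F k) x).
    case: Fx => k _ Fkx; rewrite (sumE _ _ _ Fkx) normr_nat.
    by case: (k < n)%N.
  by rewrite sum0// normr0.
Qed.

Let closure_nnsfun (h : {nnsfun T >-> R}) : closure h.
Proof.
have [s hs] : exists s : seq R, forall x, h x =
    \sum_(y <- s) y * \1_(h @^-1` [set y]) x.
  by eexists => x; rewrite {1}fimfunE fsbig_finite.
rewrite (_ : (h : T -> R) = fun x => \sum_(y <- s) y * \1_(h @^-1` [set y]) x).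
2: exact/funext.
elim: {hs}s => [|y s IH].
  under eq_fun do rewrite big_nil.
  by have := closureZ 0 (closure_sub P1); under eq_fun do rewrite mul0r.
under eq_fun do rewrite big_cons.
by apply: closureD => //; apply: closureZ; exact: closure_indic.
Qed.

(** The simple approximations increase to [f], so [f] itself dominates them. *)
Let closure_ge0 f : f \in Lfun mu 2%:E -> (forall x, 0 <= f x) -> closure f.
Proof.
move=> fL f0.
have mf : measurable_fun setT (EFin \o f).
  by apply/measurable_EFinP; exact: Lfun2_measurable.
pose h := nnsfun_approx measurableT mf.
have hf x : EFin \o h^~ x @ \oo --> (f x)%:E.
  by apply: cvg_nnsfun_approx => // y _; rewrite lee_fin.
apply: (closure_lim (f_ := h) (g := f)) => //.
- by move=> x; have := fine_cvg (hf x); exact.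
move=> n x; rewrite ger0_norm// -lee_fin /h nnsfun_approxE.
by apply: (le_approx (f := EFin \o f)) => // y _; rewrite lee_fin.
Qed.

Theorem subalgebra_dense f : f \in Lfun mu 2%:E ->
  forall e : R, 0 < e -> exists2 p, P p & (sqdist f p < e%:E)%E.
Proof.
move=> fL; suff : closure f by case.
have mf := Lfun2_measurable fL.
have m0 : measurable_fun setT ((fun=> 0) : T -> R) by exact: measurable_cst.
have cp : closure (fun x => Num.max (f x) 0).
  apply: closure_ge0 => [|x]; last by rewrite le_max lexx orbT.
  apply: Lfun2_le fL; first exact: measurable_maxr.
  by move=> x; case: (lerP (f x) 0) => h; rewrite ?normr0.
have cn : closure (fun x => Num.max (- f x) 0).
  apply: closure_ge0 => [|x]; last by rewrite le_max lexx orbT.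
  apply: Lfun2_le fL.
    by apply: measurable_maxr => //; exact: measurableT_comp.
  by move=> x; case: (lerP (- f x) 0) => h; rewrite ?normr0 ?normrN.
have := closureD cp (closureZ (-1) cn).
rewrite (_ : (fun x => _ + _) = f)//; apply/funext => x.
by case: (lerP (f x) 0) => h; case: (lerP (- f x) 0) => h'; lra.
Qed.

End subalgebra.

End L2_density.

(** * Integration and trigonometric polynomials on the circle *)

Section FTC.
Context {R : realType}.
Local Notation leb := (@lebesgue_measure R).

Lemma Rintegral_FTC (f F : R -> R) (a b : R) : a < b ->
  (forall x, a <= x <= b -> {for x, continuous f}) ->
  (forall x, a <= x <= b -> is_derive x 1 F (f x)) ->
  \int[leb]_(x in `[a, b]) f x = F b - F a.
Proof.
move=> ab cf dF.
have cF x : a <= x <= b -> {for x, continuous F}.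
  by move=> /dF dFx; apply/differentiable_continuous/derivable1_diffP.
rewrite /Rintegral (continuous_FTC2 (F := F))//.
- apply/subspace_continuousP => x /=; rewrite in_itv/= => xab.
  by apply: cvg_within_filter; exact: cf.
- split.
  + by move=> x /subset_itv_oo_cc; rewrite in_itv/= => /dF [].
  + by apply: cvg_at_right_filter; apply: cF; rewrite lexx ltW.
  + by apply: cvg_at_left_filter; apply: cF; rewrite lexx ltW.
- move=> x /subset_itv_oo_cc; rewrite in_itv/= => /dF dFx.
  by rewrite derive1E derive_val.
Qed.

Lemma continuous_integrable_itv (g : R -> R) (a b : R) : continuous g ->
  leb.-integrable `[a, b] (EFin \o g).
Proof.
move=> cg; apply: continuous_compact_integrable; first exact: segment_compact.
exact: continuous_subspaceT.
Qed.

(** As a function of its starting point, the integral over one period has derivative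
    [g (x + p) - g x = 0]. *)
Lemma Rintegral_period (g : R -> R) (p a b : R) : 0 < p -> continuous g ->
  (forall x, g (x + p) = g x) ->
  \int[leb]_(x in `[a, a + p]) g x = \int[leb]_(x in `[b, b + p]) g x.
Proof.
move=> p0 cg gp; wlog ab : a b / a <= b.
  by move=> H; have [/H|/ltW/H->] := lerP a b.
(* Starting the primitive at [a - 1] makes it differentiable from both sides at [a]. *)
pose F x := \int[leb]_(t in `[a - 1, x]) g t.
have dF (x : R) : a - 1 < x -> is_derive x 1 F (g x).
  move=> ax.
  have [] := @continuous_FTC1 _ g (BLeft (a - 1)) x (x + 1) _ _ _ (cg x).
  - by rewrite ltrDl.
  - exact: continuous_integrable_itv.
  - exact: ax.
  by move=> dFx; rewrite derive1E => <-; exact: derivableP.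
have FE x : a <= x -> \int[leb]_(t in `[x, x + p]) g t = F (x + p) - F x.
  move=> ax; apply: Rintegral_FTC => [|y _|y /andP[xy _]].
  - by rewrite ltrDl.
  - exact: cg.
  - by apply: dF; apply: lt_le_trans (le_trans ax xy); rewrite ltrBlDr ltrDl.
rewrite FE// FE//; apply/esym/eqP; rewrite -subr_eq0; apply/eqP.
have dH x : a <= x -> is_derive x 1 (fun x => F (x + p) - F x) 0.
  move=> ax.
  have a1x : a - 1 < x by rewrite ltrBlDr (le_lt_trans ax)// ltrDl.
  have d1 := dF x a1x.
  have d2 : is_derive (x + p) 1 F (g x).
    by rewrite -(gp x); apply: dF; rewrite (lt_trans a1x)// ltrDl.
  have d3 : is_derive x 1 (fun x : R => x + p) 1.
    by apply: is_derive_eq; rewrite addr0.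
  have d4 := @is_derive1_comp _ F (fun x : R => x + p) x _ _ d2 d3.
  by apply: is_derive_eq; rewrite mulr1 subrr.
have [||c] := @MVT_segment _ (fun x => F (x + p) - F x) (fun=> 0) a b ab.
- by move=> x; rewrite in_itv/= => /andP[/ltW/dH].
- apply/subspace_continuousP => x /=; rewrite in_itv/= => /andP[/dH dHx _].
  apply: cvg_within_filter.
  by apply/differentiable_continuous/derivable1_diffP.
by rewrite mul0r.
Qed.

End FTC.

(** * Nearest representatives and the quotient topology of the circle *)

Section circle_topology.
Context {R : realType}.

Lemma circle_near_rep (t : R) (y : circle R) :
  exists2 u, toC u = y & `|t - u| <= pi.
Proof.
have [v <-] := toC_surj y; have [k hk] := near_period (t - v).
exists (v + k%:~R * (2 * pi)); last by rewrite opprD addrA.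
by apply/toC_eq; rewrite addrAC subrr add0r; apply/periodP; exists k.
Qed.

Lemma mdist_circle_near (x y : circle R) : exists t u : R,
  [/\ toC t = x, toC u = y, `|t - u| <= pi & mdist x y = `|t - u|].
Proof.
have [t <-] := toC_surj x; have [u <- tu] := circle_near_rep t y.
by exists t, u; split => //; exact: circle_distE.
Qed.

(** A point at distance less than [e] from [toC t] has a representative at distance less than [e]
    from [t], because nearest representatives realise the arc length. *)
Lemma open_circle (U : set (circle R)) : open (toC @^-1` U) -> open U.
Proof.
rewrite !openE => oU x Ux.
have [t tx] := toC_surj x.
have /oU : (toC @^-1` U) t by rewrite /= tx.
move=> /nbhs_ballP[e /= e0 tU]; apply/nbhs_ballP; exists e => //= y.
rewrite ballEmdist/= -tx => xy.
have [u uy tu] := circle_near_rep t y.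
rewrite -uy; apply: tU; rewrite /ball/=.
by rewrite -circle_distE// uy.
Qed.

Lemma measurable_circle (f : circle R -> R) : continuous (f \o toC) ->
  measurable_fun [set: borel (circle R)] (f : borel (circle R) -> R).
Proof.
move=> cf; apply: (measurability _ (RGenOpens.measurableE R)).
move=> _ [_ [a [b ->] <-]]; rewrite setTI.
apply: sub_sigma_algebra; apply: open_circle.
by apply: (open_comp (f := f \o toC)) => // x _; exact: cf.
Qed.

End circle_topology.

(** * Integrals over the circle as integrals over a period *)

Section circle_integral.
Context {R : realType}.
Local Notation leb := (@lebesgue_measure R).
Local Notation mu := (circle_measure R).

Lemma measurable_lift (f : borel (circle R) -> R) : measurable_fun setT f ->
  measurable_fun setT ((fun t => f (toC t)) : measurableTypeR R -> R).
Proof. by move=> mf; exact: (measurableT_comp mf (@measurable_toC R)). Qed.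

Lemma ge0_integral_circle (f : borel (circle R) -> R) :
  measurable_fun setT f -> (forall x, 0 <= f x) ->
  (\int[mu]_x (f x)%:E =
    ((2 * pi)^-1)%R%:E * \int[leb]_(t in `[0%R, (2 * pi)%R]) (f (toC t))%:E)%E.
Proof.
move=> mf f0; rewrite ge0_integral_distribution//; last first.
- exact/measurable_EFinP.
rewrite integral_uniform//=.
- by rewrite subr0.
- apply/measurable_EFinP; exact: measurable_lift.
- by move=> x; rewrite lee_fin.
Qed.

(** Adding the bound [M] makes [f] nonnegative, so that [ge0_integral_circle] applies; the constant
    then contributes [M] to both sides and cancels. *)
Lemma Rintegral_circle0 (f : borel (circle R) -> R) :
  bounded_measurable f ->
  \int[mu]_x f x = (2 * pi)^-1 * \int[leb]_(t in `[0, (2 * pi)]) f (toC t).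
Proof.
move=> [mf [M fM]].
have pi2 : 0 < 2 * pi :> R by exact: twopi_gt0.
have mfM : measurable_fun setT (fun x => f x + M) by exact: measurable_funD.
have fM0 x : 0 <= f x + M.
  by have := fM x; rewrite ler_norml => /andP[+ _]; lra.
have icst : leb.-integrable `[0, 2 * pi] (EFin \o (fun=> M)).
  by apply: continuous_integrable_itv => x; exact: cvg_cst.
have if_ : leb.-integrable `[0, 2 * pi] (EFin \o (fun t => f (toC t))).
  apply: measurable_bounded_integrable => //.
  - by rewrite /= lebesgue_measure_itv/= lte_fin pi2 -EFinD ltry.
  - by apply: measurable_funTS; exact: measurable_lift.
  exists M; split; first exact: num_real.
  by move=> N MN x _; apply: le_trans (fM _) (ltW MN).
have := ge0_integral_circle mfM fM0.
move=> /(congr1 fine).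
rewrite fineM//; last first.
  apply: integrable_fin_num => //.
  rewrite (_ : (fun t => _) =
    ((EFin \o (fun t => f (toC t))) \+ (EFin \o (fun=> M)))%E)//.
  exact: integrableD.
rewrite -![fine (integral _ _ _)]/(Rintegral _ _ _) RintegralD//; last 2 first.
- by apply: bounded_measurable_integrable; split => //; exists M.
- by apply: bounded_measurable_integrable; split => //; exists `|M|.
rewrite RintegralD// !Rintegral_cst//=.
rewrite /= lebesgue_measure_itv/= lte_fin pi2/= subr0 probability_setT/= mulr1.
rewrite mulrDr (mulrCA _ M) mulVf ?gt_eqF// mulr1.
by move=> /addIr.
Qed.

(** The free starting point [a] is later set to [t - pi], which centres the window at [t]. *)
Lemma Rintegral_circle (a : R) (f : circle R -> R) (M : R) :
  continuous (f \o toC) -> (forall x, `|f x| <= M) ->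
  \int[mu]_x f x = (2 * pi)^-1 * \int[leb]_(t in `[a, a + 2 * pi]) f (toC t).
Proof.
move=> cf fM; rewrite Rintegral_circle0; last first.
  by split; [exact: measurable_circle|exists M].
have := @Rintegral_period _ (f \o toC) (2 * pi) 0 a (twopi_gt0) cf.
rewrite add0r => -> // x /=; congr f; apply/toC_eq.
by rewrite addrAC subrr add0r; apply/periodP; exists 1; rewrite mul1r.
Qed.

End circle_integral.

(** * The algebra of trigonometric polynomials and its density *)

Section circle_trig.
Context {R : realType}.
Local Notation leb := (@lebesgue_measure R).
Local Notation mu := (circle_measure R).

(* The phase [a] lets one formula treat cosines and sines at once. *)
Definition cosphase (k : int) (a : R) (x : circle R) : R :=
  cos (k%:~R * angle x + a).

Lemma cosphaseE k a t : cosphase k a (toC t) = cos (k%:~R * t + a).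
Proof.
have [l lE] := angle_toC t.
by rewrite /cosphase lE mulrDr mulrA -intrM addrAC cosDperiod.
Qed.

Lemma cosphaseD k a x :
  cosphase k a x = cos a * cosphase k 0 x - sin a * cosphase k (- (pi / 2)) x.
Proof.
by rewrite /cosphase cosD cosBpihalf addr0 mulrC (mulrC (sin a)).
Qed.

Lemma cosphaseN k a x : cosphase (- k) a x = cosphase k (- a) x.
Proof.
by rewrite /cosphase -[RHS]cosN opprD opprK rmorphN mulNr.
Qed.

Lemma cosphase0 a x : cosphase 0 a x = cos a.
Proof. by rewrite /cosphase mul0r add0r. Qed.

Lemma cosphaseM k a l b x : cosphase k a x * cosphase l b x =
  2^-1 * cosphase (k + l) (a + b) x + 2^-1 * cosphase (k - l) (a - b) x.
Proof.
rewrite /cosphase -mulrDr.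
have -> : (k + l)%:~R * angle x + (a + b) =
    (k%:~R * angle x + a) + (l%:~R * angle x + b) by rewrite intrD; ring.
have -> : (k - l)%:~R * angle x + (a - b) =
    (k%:~R * angle x + a) - (l%:~R * angle x + b) by rewrite intrB; ring.
by rewrite cosB (cosD (_ + a)); field.
Qed.

Lemma cosphase_le1 k a x : `|cosphase k a x| <= 1.
Proof. exact: cos_max. Qed.

Lemma is_derive_sin_affine (k a t : R) :
  is_derive t (1 : R) (fun t => sin (k * t + a)) (k * cos (k * t + a)).
Proof.
apply: is_derive_eq.
by rewrite /GRing.scale/= !(mul0r, mulr0, mulr1, addr0, add0r) mulrC.
Qed.

Lemma is_derive_cos_affine (k a t : R) :
  is_derive t (1 : R) (fun t => cos (k * t + a)) (- (k * sin (k * t + a))).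
Proof.
apply: is_derive_eq.
by rewrite /GRing.scale/= !(mul0r, mulr0, mulr1, addr0, add0r) mulNr mulrC.
Qed.

Lemma continuous_cosphase k a : continuous (cosphase k a \o toC).
Proof.
have -> : cosphase k a \o toC = fun t => cos (k%:~R * t + a).
  by apply/funext => t; exact: cosphaseE.
move=> t; have := is_derive_cos_affine k%:~R a t => ?.
exact/differentiable_continuous/derivable1_diffP.
Qed.

Lemma cosphase_bounded_measurable k a :
  bounded_measurable (cosphase k a : borel (circle R) -> R).
Proof.
split; first by apply: measurable_circle; exact: continuous_cosphase.
by exists 1 => x; exact: cosphase_le1.
Qed.

Lemma Rintegral_cosphase k a : \int[mu]_x cosphase k a x = (k == 0)%:R * cos a.
Proof.
have pi2 : 0 < 2 * pi :> R by exact: twopi_gt0.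
rewrite (Rintegral_circle 0 (@continuous_cosphase k a) (cosphase_le1 k a)) add0r.
have [->|k0] := eqVneq k 0.
  under eq_Rintegral do rewrite cosphase0.
  rewrite Rintegral_cst//= lebesgue_measure_itv/= lte_fin pi2/= subr0 mul1r.
  by rewrite mulrCA mulVf ?mulr1// gt_eqF.
have k0' : k%:~R != 0 :> R by rewrite intr_eq0.
rewrite mul0r.
pose F (t : R) := k%:~R^-1 * sin (k%:~R * t + a).
have -> : \int[leb]_(t in `[0, (2 * pi)]) cosphase k a (toC t) = F (2 * pi) - F 0.
  apply: Rintegral_FTC => // x _; first exact: continuous_cosphase.
  have := is_derive_sin_affine k%:~R a x => h.
  by apply: is_derive_eq; rewrite /GRing.scale/= mulrA mulVf// mul1r cosphaseE.
by rewrite /F mulr0 add0r (addrC (_ * (2 * pi))) sinDperiod subrr mulr0.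
Qed.

(** Lists of coefficient, frequency and phase, repetitions allowed: sums are concatenations, and an
    induction adds one mode at a time. *)
Definition trigpoly (p : borel (circle R) -> R) :=
  exists s : seq (R * int * R),
    p = fun x => \sum_(i <- s) i.1.1 * cosphase i.1.2 i.2 x.

Lemma trigpoly_ind (Q : (borel (circle R) -> R) -> Prop) :
  Q (fun=> 0) ->
  (forall c k a p, Q p -> Q (fun x => c * cosphase k a x + p x)) ->
  forall p, trigpoly p -> Q p.
Proof.
move=> Q0 QS p [s ->]; elim: s => [|[[c k] a] s IH].
  by under eq_fun do rewrite big_nil.
by under eq_fun do rewrite big_cons/=; exact: QS.
Qed.

Lemma trigpoly_cosphase k a : trigpoly (cosphase k a).
Proof.
exists [:: (1, k, a)]; apply/funext => x.
by rewrite big_cons big_nil addr0 mul1r.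
Qed.

Lemma trigpoly_cst c : trigpoly (fun=> c).
Proof.
exists [:: (c, 0, 0)]; apply/funext => x.
by rewrite big_cons big_nil addr0 cosphase0 cos0 mulr1.
Qed.

Lemma trigpolyD p q : trigpoly p -> trigpoly q -> trigpoly (fun x => p x + q x).
Proof.
move=> [s ->] [r ->]; exists (s ++ r); apply/funext => x.
by rewrite big_cat.
Qed.

Lemma trigpolyZ c p : trigpoly p -> trigpoly (fun x => c * p x).
Proof.
move=> [s ->]; exists [seq (c * i.1.1, i.1.2, i.2) | i <- s].
apply/funext => x; rewrite big_map mulr_sumr.
by apply: eq_bigr => i _; rewrite mulrA.
Qed.

Lemma trigpolyM p q : trigpoly p -> trigpoly q -> trigpoly (fun x => p x * q x).
Proof.
move=> + tq; move: p; apply: trigpoly_ind => [|c k a p IH].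
  by under eq_fun do rewrite mul0r; exact: trigpoly_cst.
under eq_fun do rewrite mulrDl; apply: trigpolyD => //.
move: q tq {IH}; apply: trigpoly_ind => [|d l b q IH].
  by under eq_fun do rewrite mulr0; exact: trigpoly_cst.
under eq_fun do rewrite mulrDr mulrACA cosphaseM; apply: trigpolyD => //.
apply: trigpolyZ; apply: trigpolyD; apply: trigpolyZ; exact: trigpoly_cosphase.
Qed.

Lemma trigpoly_bounded_measurable p : trigpoly p -> bounded_measurable p.
Proof.
move: p; apply: trigpoly_ind => [|c k a p [mp [M pM]]].
  by split; [exact: measurable_cst|exists 0 => x; rewrite normr0].
have [mc [N cN]] := cosphase_bounded_measurable k a; split.
  by apply: measurable_funD => //; exact: measurable_funM.
exists (`|c| * N + M) => x; apply: le_trans (ler_normD _ _) _.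
by rewrite lerD// normrM ler_wpM2l.
Qed.

Lemma ltr_cos_norm (x y : R) : `|x| <= pi -> 0 <= y <= pi ->
  (cos y < cos x) = (`|x| < y).
Proof.
by move=> xpi ypi; rewrite -(cos_norm x) ltr_cos ?in_itv//= xpi andbT.
Qed.

(** The open arc of radius [1 / (n + 1)] about [toC q], since [cos] decreases on [[0, pi]]. The
    cosine makes it a level set of a trigonometric polynomial. *)
Let arc (q : R) (n : nat) : set (borel (circle R)) :=
  [set x | cos n.+1%:R^-1 < cosphase 1 (- q) x].

Let arc_threshold q n : threshold_sets trigpoly (arc q n).
Proof.
(* The difference of two cosines lies in [[-2, 2]], so a quarter of it added to [1/2] lies in
   [[0, 1]], and it drops below [1/2] exactly on the arc. *)
exists (fun x => 2^-1 + 4^-1 * (cos n.+1%:R^-1 + -1 * cosphase 1 (- q) x)); split.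
- apply: trigpolyD; first exact: trigpoly_cst.
  apply: trigpolyZ; apply: trigpolyD; first exact: trigpoly_cst.
  by apply: trigpolyZ; exact: trigpoly_cosphase.
- move=> x; have := cosphase_le1 1 (- q) x; have := cos_max (n.+1%:R^-1 : R).
  by rewrite !ler_norml => /andP[h1 h2] /andP[h3 h4]; lra.
- by apply/seteqP; split => x; rewrite /arc/= => h; lra.
Qed.

(** The arcs with rational centre and radius [1 / (n + 1)] form a countable base of the topology. *)
Lemma trigpoly_generates :
  @measurable _ (borel (circle R)) = <<s threshold_sets trigpoly >>.
Proof.
apply/seteqP; split; last first.
  apply: smallest_sub.
    by split => [|A mA|F mF]; [exact: measurable0|rewrite setTD; exact: measurableC|
      exact: bigcup_measurable].
  move=> _ [p [/trigpoly_bounded_measurable[mp _] _ ->]].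
  rewrite (_ : [set x | _] = setT `&` p @^-1` `]-oo, 2^-1[); first exact: mp.
  by rewrite setTI; apply/seteqP; split => x; rewrite /= in_itv.
apply: smallest_sub; first exact: smallest_sigma_algebra.
move=> U oU.
pose V n (q : rat) := if `[< arc (ratr q) n `<=` U >] then arc (ratr q) n else set0.
have -> : U = \bigcup_n \bigcup_q V n q.
  apply/seteqP; split => [x Ux|x [n _ [q _]]]; last first.
    by rewrite /V; case: asboolP => // + Vx; exact.
  have [t tx] := toC_surj x.
  have : nbhs (toC t) U by rewrite tx; exact: open_nbhs_nbhs.
  move=> /continuous_toC/nbhs_ballP[e /= e0 tU].
  (* Both [t] and any point of the arc lie within [1 / (n + 1) < e / 2] of the centre [q], so the
     arc stays within [e] of [t]. *)
  pose n := Num.truncn (2 / e).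
  have ne : n.+1%:R^-1 < e / 2.
    by rewrite -[ltRHS]invf_div ltf_pV2 ?posrE ?divr_gt0// truncnS_gt.
  have n1 : n.+1%:R^-1 <= 1 :> R by rewrite invf_le1// ler1n.
  have npi : 0 <= (n.+1%:R^-1 : R) <= pi.
    by rewrite invr_ge0 ler0n/= (le_trans n1)// (le_trans _ (pi_ge2 R))// ler1n.
  have [q] : exists q : rat, ratr q \in `]t - n.+1%:R^-1, t + n.+1%:R^-1[.
    apply: rat_in_itvoo; rewrite ltrD2l gtrN//.
  rewrite in_itv/= => tq.
  have {}tq : `|t - ratr q| < n.+1%:R^-1.
    by move: tq; rewrite ltr_norml; move: (n.+1%:R^-1) (ratr q) => u v; lra.
  exists n => //; exists q => //; rewrite /V; case: asboolP => [_|[]].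
    rewrite /arc/= -tx cosphaseE mul1r ltr_cos_norm//.
    by rewrite (le_trans (ltW tq))//; case/andP: npi.
  move=> y; rewrite /arc/=.
  have [u <- qu] := circle_near_rep (ratr q) y.
  rewrite cosphaseE mul1r ltr_cos_norm// 1?distrC// => uq.
  apply: tU; rewrite /ball/=; apply: le_lt_trans (ler_distD (ratr q) _ _) _.
  by move: ne uq tq; move: (n.+1%:R^-1) => dl; lra.
have mV n q : <<s threshold_sets trigpoly >> (V n q).
  rewrite /V; case: asboolP => _; last first.
    by case: (smallest_sigma_algebra setT (threshold_sets trigpoly)).
  by apply: sub_sigma_algebra; exact: arc_threshold.
apply: (@bigcupT_measurable _ (g_sigma_algebraType (threshold_sets trigpoly))) => n.
apply: (@bigcupT_measurable_rat _ (g_sigma_algebraType (threshold_sets trigpoly))) => q.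
exact: mV.
Qed.

Theorem trigpoly_dense f : f \in Lfun mu 2%:E -> forall e : R, 0 < e ->
  exists2 p, trigpoly p & (\int[mu]_x ((f x - p x) ^+ 2)%:E < e%:E)%E.
Proof.
apply: subalgebra_dense.
- exact: trigpoly_cst.
- exact: trigpolyD.
- exact: trigpolyM.
- exact: trigpolyZ.
- exact: trigpoly_bounded_measurable.
- exact: trigpoly_generates.
Qed.

End circle_trig.

(** * The sum of the inverse odd squares *)

Section is_derive_fun.
Context {R : realType}.

Lemma is_derive_replace (f : R -> R) (x a b : R) :
  is_derive x 1 f a -> a = b -> is_derive x 1 f b.
Proof. by move=> + <-. Qed.

Lemma is_derive_continuous (f : R -> R) (x a : R) :
  is_derive x 1 f a -> {for x, continuous f}.
Proof. by move=> ?; exact/differentiable_continuous/derivable1_diffP. Qed.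

Lemma is_derive_mul (f g : R -> R) (x df dg : R) :
  is_derive x 1 f df -> is_derive x 1 g dg ->
  is_derive x (1 : R) (fun y => f y * g y) (df * g x + f x * dg).
Proof.
move=> hf hg; have := is_deriveM hf hg.
by rewrite /GRing.scale/= addrC (mulrC df).
Qed.

Lemma is_derive_add (f g : R -> R) (x df dg : R) :
  is_derive x 1 f df -> is_derive x 1 g dg ->
  is_derive x (1 : R) (fun y => f y + g y) (df + dg).
Proof. by move=> hf hg; exact: is_deriveD. Qed.

Lemma is_derive_scale (c : R) (f : R -> R) (x df : R) :
  is_derive x 1 f df -> is_derive x (1 : R) (fun y => c * f y) (c * df).
Proof. by move=> hf; exact: (is_deriveZ c). Qed.

Lemma is_derive_cosX n (x : R) : is_derive x (1 : R) (fun y => cos y ^+ n.+1)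
  (- (n.+1%:R * cos x ^+ n * sin x)).
Proof.
elim: n => [|n IH].
  by rewrite expr0 mulr1 mul1r; exact: is_derive_cos.
under eq_fun do rewrite exprS.
apply: is_derive_replace (is_derive_mul (is_derive_cos x) IH) _.
by rewrite -[n.+2%:R]natr1 exprS; ring.
Qed.

Lemma is_derive_sqr (x : R) : is_derive x (1 : R) (fun y => y ^+ 2) (2 * x).
Proof.
apply: is_derive_replace
  (is_derive_mul (is_derive_id x (1 : R)) (is_derive_id x (1 : R))) _.
by ring.
Qed.

End is_derive_fun.

(* With [I n] the integral of [cos ^ n] and [J n] that of [x ^ 2 cos ^ n] over
   [[0, pi / 2]], integration by parts gives
   [2 / n ^ 2 = J (n - 2) / I (n - 2) - J n / I n], so the sum telescopes. *)
Section odd_zeta2.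
Context {R : realType}.
Local Notation leb := (@lebesgue_measure R).

Let I n : R := \int[leb]_(x in `[0, (pi / 2)]) cos x ^+ n.
Let J n : R := \int[leb]_(x in `[0, (pi / 2)]) (x ^+ 2 * cos x ^+ n).

Let pihalf_gt0 : 0 < pi / 2 :> R.
Proof. by rewrite divr_gt0// pi_gt0. Qed.

Let continuous_cosX n : continuous (fun x : R => cos x ^+ n).
Proof.
move=> x; apply: (@continuous_comp R R R cos (fun y => y ^+ n)).
  exact: continuous_cos.
exact: exprn_continuous.
Qed.

Let continuous_sqr_cosX n : continuous (fun x : R => x ^+ 2 * cos x ^+ n).
Proof.
by move=> x; apply: cvgM; [exact: exprn_continuous|exact: continuous_cosX].
Qed.

Let IE n (c : R) : \int[leb]_(x in `[0, (pi / 2)]) (c * cos x ^+ n) = c * I n.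
Proof.
rewrite RintegralZl//; apply: continuous_integrable_itv.
exact: continuous_cosX.
Qed.

Let JE n (c : R) :
  \int[leb]_(x in `[0, (pi / 2)]) (c * (x ^+ 2 * cos x ^+ n)) = c * J n.
Proof.
rewrite RintegralZl//; apply: continuous_integrable_itv.
exact: continuous_sqr_cosX.
Qed.

Let integrable_cosX n (c : R) :
  leb.-integrable `[0, (pi / 2)] (EFin \o (fun x => c * cos x ^+ n)).
Proof.
apply: continuous_integrable_itv => x.
by apply: cvgM; [exact: cvg_cst|exact: continuous_cosX].
Qed.

Let integrable_sqr_cosX n (c : R) :
  leb.-integrable `[0, (pi / 2)] (EFin \o (fun x => c * (x ^+ 2 * cos x ^+ n))).
Proof.
apply: continuous_integrable_itv => x.
by apply: cvgM; [exact: cvg_cst|exact: continuous_sqr_cosX].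
Qed.

(** Wallis' recurrence: [sin x * cos x ^ (n + 1)] vanishes at both endpoints. *)
Let I_rec n : n.+2%:R * I n.+2 = n.+1%:R * I n.
Proof.
apply/eqP; rewrite -subr_eq0 -!IE -RintegralB//; apply/eqP.
pose F (x : R) := sin x * cos x ^+ n.+1.
transitivity (F (pi / 2) - F 0); last first.
  by rewrite /F sin0 mul0r cos_pihalf expr0n/= mulr0 subr0.
apply: Rintegral_FTC => // x _.
  apply: cvgB; apply: cvgM; (try exact: cvg_cst); exact: continuous_cosX.
apply: is_derive_replace (is_derive_mul (is_derive_sin x) (is_derive_cosX n x)) _.
rewrite [cos x ^+ n.+2]exprS [cos x ^+ n.+1]exprS.
have := cos2Dsin2 x; rewrite -[n.+2%:R]natr1.
move: (cos x) (sin x) (cos x ^+ n) (n.+1%:R) => c s p N h.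
apply/eqP; rewrite -subr_eq0; apply/eqP.
transitivity (N * p * (1 - (c ^+ 2 + s ^+ 2))); first by ring.
by rewrite h subrr mulr0.
Qed.

Let IJ_rec n : I n.+2 + n.+2%:R / 2 * (n.+2%:R * J n.+2 - n.+1%:R * J n) = 0.
Proof.
(* The boundary terms of two integrations by parts of [cos ^ (n + 2)]; they vanish at both
   endpoints. *)
pose F (x : R) := x * cos x ^+ n.+2 + n.+2%:R / 2 * (x ^+ 2 * (cos x ^+ n.+1 * sin x)).
transitivity (F (pi / 2) - F 0); last first.
  by rewrite /F cos_pihalf !expr0n/= !(mul0r, mulr0) addr0 subr0.
have -> : I n.+2 + n.+2%:R / 2 * (n.+2%:R * J n.+2 - n.+1%:R * J n) =
  1 * I n.+2 + ((n.+2%:R / 2 * n.+2%:R) * J n.+2 - (n.+2%:R / 2 * n.+1%:R) * J n) by ring.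
rewrite -!IE -!JE -RintegralB// -RintegralD//; last first.
  apply: continuous_integrable_itv => x.
  by apply: cvgB; apply: cvgM; (try exact: cvg_cst); exact: continuous_sqr_cosX.
apply: Rintegral_FTC => // x _.
  apply: cvgD; first by apply: cvgM; [exact: cvg_cst|exact: continuous_cosX].
  by apply: cvgB; apply: cvgM; (try exact: cvg_cst); exact: continuous_sqr_cosX.
apply: is_derive_replace (is_derive_add
  (is_derive_mul (is_derive_id x (1 : R)) (is_derive_cosX n.+1 x))
  (is_derive_scale (n.+2%:R / 2) (is_derive_mul (is_derive_sqr x)
    (is_derive_mul (is_derive_cosX n x) (is_derive_sin x))))) _.
rewrite ![cos x ^+ n.+2]exprS ![cos x ^+ n.+1]exprS.
have := cos2Dsin2 x; rewrite -[n.+2%:R]natr1.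
move: (cos x) (sin x) (cos x ^+ n) (n.+1%:R) => c s p N h.
apply/eqP; rewrite -subr_eq0; apply/eqP.
transitivity ((N + 1) / 2 * N * x ^+ 2 * p * (1 - (c ^+ 2 + s ^+ 2))); first by field.
by rewrite h subrr mulr0.
Qed.

Let I1 : I 1 = 1.
Proof.
transitivity (sin (pi / 2) - sin 0 : R); last by rewrite sin_pihalf sin0 subr0.
apply: Rintegral_FTC => // x _; first exact: continuous_cosX.
Qed.

Let J1 : J 1 = pi ^+ 2 / 4 - 2.
Proof.
pose F (x : R) := x ^+ 2 * sin x + 2 * (x * cos x) + - 2 * sin x.
transitivity (F (pi / 2) - F 0); last first.
  by rewrite /F sin_pihalf cos_pihalf sin0 !(mul0r, mulr0, mulr1) expr_div_n; field.
apply: Rintegral_FTC => // x _; first exact: continuous_sqr_cosX.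
apply: is_derive_replace (is_derive_add
  (is_derive_add (is_derive_mul (is_derive_sqr x) (is_derive_sin x))
  (is_derive_scale 2 (is_derive_mul (is_derive_id x (1 : R)) (is_derive_cos x))))
  (is_derive_scale (- 2) (is_derive_sin x))) _.
by rewrite expr1; ring.
Qed.

Let I_gt0 k : 0 < I (2 * k).+1.
Proof.
elim: k => [|k IH]; first by rewrite I1 ltr01.
rewrite mulnS -(@pmulr_rgt0 _ (2 * k).+3%:R)//.
by have := I_rec (2 * k).+1 => /= ->; rewrite mulr_gt0.
Qed.

(** The difference [sin x - x cos x] is the integral of [y sin y] over [[0, x]]. *)
Lemma mulr_cos_le_sin (x : R) : 0 <= x <= pi / 2 -> x * cos x <= sin x.
Proof.
move=> /andP[]; rewrite le_eqVlt => /predU1P[<- _|x0 xpi].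
  by rewrite mul0r sin0.
rewrite -subr_ge0.
pose F (y : R) := sin y + - 1 * (y * cos y).
have -> : sin x - x * cos x = F x - F 0.
  by rewrite /F sin0 mul0r mulr0 addr0 subr0 mulN1r.
have <- : \int[leb]_(y in `[0, x]) (y * sin y) = F x - F 0.
  apply: Rintegral_FTC => // y _.
    by apply: cvgM; [exact: cvg_id|exact: continuous_sin].
  apply: is_derive_replace (is_derive_add (is_derive_sin y) (is_derive_scale (- 1)
    (is_derive_mul (is_derive_id y (1 : R)) (is_derive_cos y)))) _.
  by ring.
apply: Rintegral_ge0 => y /=; rewrite in_itv/= => /andP[y0 yx].
rewrite mulr_ge0// sin_ge0_pi// y0/= (le_trans yx)// (le_trans xpi)//.
by rewrite ler_pdivrMr// ler_peMr// ?pi_ge0// ler1n.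
Qed.

(** Squaring [x cos x <= sin x] bounds the integrand by [sin^2 cos^n = cos^n - cos^(n+2)]. This
    makes the remainder of the telescoping sum vanish. *)
Let J_le n : J n.+2 <= I n - I n.+2.
Proof.
rewrite -[I n]mul1r -[I n.+2]mul1r -!IE -RintegralB//.
rewrite -[J n.+2]mul1r -JE; apply: le_Rintegral => //.
  apply: continuous_integrable_itv => x.
  by apply: cvgB; apply: cvgM; (try exact: cvg_cst); exact: continuous_cosX.
move=> x /=; rewrite in_itv/= => xpi; rewrite !mul1r.
have -> : x ^+ 2 * cos x ^+ n.+2 = (x * cos x) ^+ 2 * cos x ^+ n.
  by rewrite -(addn2 n) exprD; ring.
have -> : cos x ^+ n - cos x ^+ n.+2 = sin x ^+ 2 * cos x ^+ n.
  have -> : sin x ^+ 2 = 1 - cos x ^+ 2 by rewrite -(cos2Dsin2 x); ring.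
  by rewrite -(addn2 n) exprD; ring.
have /andP[x0 xp] := xpi.
have cx : 0 <= cos x by rewrite cos_ge0_pihalf// xp (le_trans _ x0)// oppr_le0 ltW.
rewrite ler_wpM2r ?exprn_ge0// lerXn2r ?nnegrE ?mulr_ge0//.
  by apply: le_trans (mulr_cos_le_sin xpi); rewrite mulr_ge0.
exact: mulr_cos_le_sin.
Qed.

Let J_ge0 n : 0 <= J n.
Proof.
apply: Rintegral_ge0 => x /=; rewrite in_itv/= => /andP[x0 xp].
rewrite mulr_ge0 ?sqr_ge0// exprn_ge0// cos_ge0_pihalf// xp (le_trans _ x0)//.
by rewrite oppr_le0 ltW.
Qed.

Let r k := J (2 * k).+1 / I (2 * k).+1.

(** The algebra of one telescoping step: the two recurrences are solved for [i1] and [j1]. *)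
Let ratio_step (N3 N2 i1 i3 j1 j3 : R) : N3 != 0 -> N2 != 0 -> i3 != 0 ->
  N3 * i3 = N2 * i1 -> i3 + N3 / 2 * (N3 * j3 - N2 * j1) = 0 ->
  2 / N3 ^+ 2 = j1 / i1 - j3 / i3.
Proof.
move=> n3 n2 hi3 h1 h2.
have -> : i1 = N3 * i3 / N2 by rewrite h1; field.
have -> : j1 = (N3 * j3 + 2 / N3 * i3) / N2.
  apply/eqP; rewrite -subr_eq0; apply/eqP.
  transitivity (- 2 / N2 / N3 * (i3 + N3 / 2 * (N3 * j3 - N2 * j1))).
    by field; rewrite n2 n3.
  by rewrite h2 mulr0.
by field; rewrite ?hi3 ?n3 ?n2.
Qed.

Let r_rec k : 2 / (2 * k).+3%:R ^+ 2 = r k - r k.+1.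
Proof.
rewrite /r mulnS; apply: (ratio_step (N2 := (2 * k).+2%:R)).
- by rewrite pnatr_eq0.
- by rewrite pnatr_eq0.
- by have := I_gt0 k.+1; rewrite mulnS => /lt0r_neq0.
- exact: I_rec.
- exact: IJ_rec.
Qed.

Let r_ge0 k : 0 <= r k.
Proof. by rewrite divr_ge0// ltW. Qed.

(** By [J_le] the ratio is at most [I (2k+1) / I (2k+3) - 1], and by [I_rec] this is
    [(2k+3) / (2k+2) - 1]. *)
Let r_le k : r k.+1 <= (2 * k).+2%:R^-1.
Proof.
rewrite /r mulnS ler_pdivrMr; last by have := I_gt0 k.+1; rewrite mulnS.
apply: le_trans (J_le (2 * k).+1) _.
have := I_rec (2 * k).+1; rewrite -[(2 * k).+3%:R]natr1.
change (2 + 2 * k).+1 with (2 * k).+3.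
have : ((2 * k).+2%:R : R) != 0 by rewrite pnatr_eq0.
move: (_.+2%:R) (I _) (I _) => N i1 i3 n2 h.
have -> : i1 = (N + 1) * i3 / N by rewrite h; field.
by rewrite le_eqVlt; apply/orP; left; apply/eqP; field.
Qed.

Let sum_inv_odd_sqr n :
  \sum_(k < n.+1) 2 / (2 * k).+1%:R ^+ 2 = pi ^+ 2 / 4 - r n.
Proof.
elim: n => [|n IH].
  (* The first term 2 is supplied by [r 0 = J 1 / I 1 = pi^2 / 4 - 2]. *)
  by rewrite big_ord_recl big_ord0 /r muln0 J1 I1 expr1n; field.
by rewrite big_ord_recr/= IH mulnS r_rec; ring.
Qed.

Lemma cvg_sum_inv_odd_sqr :
  \sum_(k < n) (2 / (2 * k).+1%:R ^+ 2 : R) @[n --> \oo] --> pi ^+ 2 / 4.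
Proof.
rewrite -(cvg_shiftn 2)/=.
under eq_fun do rewrite addn2 sum_inv_odd_sqr.
suff h : r n.+1 @[n --> \oo] --> (0 : R).
  have hh : pi ^+ 2 / 4 - r n.+1 @[n --> \oo] --> pi ^+ 2 / 4 - 0.
    exact: cvgB (cvg_cst _) h.
  by rewrite subr0 in hh; exact: hh.
apply: (@squeeze_cvgr _ _ _ _ (fun=> 0) (fun n => n.+1%:R^-1)).
- apply: nearW => n; rewrite r_ge0/= (le_trans (r_le n))//.
  by rewrite lef_pV2 ?posrE// ler_nat mul2n -addnn !ltnS leqW// leq_addr.
- exact: cvg_cst.
- exact: cvg_harmonic.
Qed.

End odd_zeta2.

(** * The MDS operator of the circle *)

Section circle_MDS.
Context {R : realType}.
Local Notation leb := (@lebesgue_measure R).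
Local Notation mu := (circle_measure R).
Local Notation KA := (@KA R (mm_circle R)).
Local Notation KB := (@KB R (mm_circle R)).
Implicit Types (x y : borel (circle R)) (k : int).

Lemma cos_intrpi k : cos (k%:~R * pi) = (-1) ^ k :> R.
Proof.
have cosn (n : nat) : cos (n%:R * pi) = (-1) ^+ n :> R.
  by rewrite mulr_natl -[pi *+ n]add0r (alternatingn (@cosDpi R)) cos0 mulr1.
case: k => n; first exact: cosn.
rewrite NegzE rmorphN/= mulNr cosN cosn.
by rewrite -[RHS]/((-1) ^+ n.+1)^-1 -exprVn invrN1.
Qed.

Lemma sin_intrpi k : sin (k%:~R * pi) = 0 :> R.
Proof.
have sinn (n : nat) : sin (n%:R * pi) = 0 :> R.
  by rewrite mulr_natl -[pi *+ n]add0r (alternatingn (@sinDpi R)) sin0 mulr0.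
case: k => n; first exact: sinn.
by rewrite NegzE rmorphN/= mulNr sinN sinn oppr0.
Qed.

Lemma circle_lambdaE k : circle_lambda k = - cos (k%:~R * pi) / k%:~R ^+ 2 :> R.
Proof.
by rewrite /circle_lambda cos_intrpi exprzDr ?unitrN1// expr1z mulrN1.
Qed.

(* Junk value: [(-1) / 0 = 0] is the eigenvalue of the constants. *)
Lemma circle_lambda0 : circle_lambda 0 = 0 :> R.
Proof. by rewrite /circle_lambda expr0n/= invr0 mulr0. Qed.

Lemma circle_lambdaN k : circle_lambda (- k) = circle_lambda k :> R.
Proof. by rewrite !circle_lambdaE rmorphN/= sqrrN [- _ * pi]mulNr cosN. Qed.

Lemma mdist_circle_le x y : mdist (x : circle R) (y : circle R) <= pi.
Proof. by have [t [u [_ _ tu ->]]] := mdist_circle_near (x : circle R) y. Qed.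

Lemma KA_toC (t s : R) : `|t - s| <= pi -> KA (toC t) (toC s) = - 2^-1 * (t - s) ^+ 2.
Proof.
move=> ts; rewrite /Defs.KA.
by rewrite [mdist _ _](circle_distE ts) -normrX ger0_norm// sqr_ge0.
Qed.

Lemma KA_sym x y : KA x y = KA y x.
Proof. by rewrite /Defs.KA metric_sym. Qed.

Lemma KA_bounded x y : `|KA x y| <= 2^-1 * pi ^+ 2.
Proof.
rewrite /Defs.KA normrM normrN (@ger0_norm _ 2^-1)//.
apply: ler_wpM2l; first by rewrite invr_ge0.
rewrite normrX ger0_norm ?mdist_ge0// lerXn2r ?nnegrE ?mdist_ge0 ?pi_ge0//.
exact: mdist_circle_le.
Qed.

Lemma continuous_KA x : continuous (KA x \o toC).
Proof.
have cd : continuous (fun s => mdist (x : circle R) (toC s)).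
  move=> s; apply/cvgrPdist_lt => e e0.
  apply/nbhs_ballP; exists e => //= u su.
  apply: le_lt_trans su; apply: le_trans (circle_dist_le s u).
  rewrite -[circle_dist _ _]/(mdist (toC s) (toC u)) ler_norml.
  have := metric_triangle (x : circle R) (toC s) (toC u).
  have := metric_triangle (x : circle R) (toC u) (toC s).
  by rewrite (metric_sym (toC u)); lra.
move=> s; apply: cvgM; first exact: cvg_cst.
by rewrite expr2; apply: cvgM; exact: cd.
Qed.

(** On the window centred at [t] the primitive [- (s - t)^3 / 6] changes by [- pi^3 / 3], which is
    then divided by [2 pi]. *)
Lemma Rintegral_KA x : \int[mu]_y KA x y = - (pi ^+ 2 / 6).
Proof.
have [t <-] := toC_surj (x : circle R).
rewrite (@Rintegral_circle _ (t - pi) _ _ (@continuous_KA (toC t)) (KA_bounded (toC t))).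
pose F (s : R) := - 6^-1 * ((s + - t) ^+ 2 * (s + - t)).
have pi2 : t - pi < t - pi + 2 * pi by rewrite ltrDl; exact: twopi_gt0.
have -> : \int[leb]_(s in `[t - pi, t - pi + 2 * pi]) KA (toC t) (toC s) =
    \int[leb]_(s in `[t - pi, t - pi + 2 * pi]) (- 2^-1 * (s + - t) ^+ 2).
  apply: eq_Rintegral => s; rewrite inE/= in_itv/= => ts.
  by rewrite KA_toC; [ring|rewrite ler_norml; lra].
have dt s : is_derive s (1 : R) (fun s => s + - t) 1.
  apply: is_derive_replace (is_derive_add (is_derive_id s (1 : R))
    (is_derive_cst (- t) s (1 : R))) _.
  by rewrite addr0.
have dt2 s : is_derive s (1 : R) (fun s => (s + - t) ^+ 2) (2 * (s + - t)).
  by apply: is_derive_replace (is_derive_mul (dt s) (dt s)) _; ring.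
have -> : \int[leb]_(s in `[t - pi, t - pi + 2 * pi]) (- 2^-1 * (s + - t) ^+ 2) =
   F (t - pi + 2 * pi) - F (t - pi).
  apply: Rintegral_FTC => // s _.
    apply: cvgM; first exact: cvg_cst.
    exact: is_derive_continuous (dt2 s).
  apply: is_derive_replace
    (is_derive_scale (- 6^-1) (is_derive_mul (dt2 s) (dt s))) _.
  by field.
have : (pi : R) != 0 by rewrite gt_eqF// pi_gt0.
by rewrite /F; move: (pi : R) => p p0; field.
Qed.

(** All three means equal the same constant [m], so centring adds [- m - m + m = - m]. *)
Lemma KBE x y : KB x y = KA x y + pi ^+ 2 / 6.
Proof.
rewrite /Defs.KB /= Rintegral_KA.
have -> : \int[mu]_w KA w y = - (pi ^+ 2 / 6).
  by rewrite -(Rintegral_KA y); apply: eq_Rintegral => w _; exact: KA_sym.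
have -> : \int[mu]_w (\int[mu]_z KA w z) = - (pi ^+ 2 / 6).
  under eq_Rintegral do rewrite Rintegral_KA.
  by rewrite Rintegral_cst//= probability_setT mulr1.
by ring.
Qed.

Lemma KB_bounded x y : `|KB x y| <= pi ^+ 2.
Proof.
have := KA_bounded x y; rewrite KBE !ler_norml => /andP[h1 h2].
have := sqr_ge0 (pi : R); lra.
Qed.

Lemma continuous_KB x : continuous (KB x \o toC).
Proof.
have -> : KB x \o toC = fun s => (KA x \o toC) s + pi ^+ 2 / 6.
  by apply/funext => s; exact: KBE.
by move=> s; apply: cvgD; [exact: continuous_KA|exact: cvg_cst].
Qed.

Lemma KB_bounded_measurable x : bounded_measurable (KB x).
Proof.
split; last by exists (pi ^+ 2) => y; exact: KB_bounded.
by apply: measurable_circle; exact: continuous_KB.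
Qed.

Lemma TKB_cosphase k (a : R) :
  TKB (mm_circle R) (cosphase k a) = fun x => circle_lambda k * cosphase k a x.
Proof.
apply/funext => x; rewrite /TKB/=.
have [->|k0] := eqVneq k 0.
  (* For constants, the centred kernel has mean zero in its second variable. *)
  rewrite circle_lambda0 mul0r.
  under eq_Rintegral do rewrite cosphase0.
  rewrite RintegralZr//; last first.
    exact/bounded_measurable_integrable/KB_bounded_measurable.
  under eq_Rintegral do rewrite KBE.
  rewrite RintegralD//; last 2 first.
  - apply: bounded_measurable_integrable; split.
      by apply: measurable_circle; exact: continuous_KA.
    by exists (2^-1 * pi ^+ 2) => y; exact: KA_bounded.
  - by apply: bounded_measurable_integrable; split => //; exists `|pi ^+ 2 / 6|.
  by rewrite Rintegral_KA Rintegral_cst//= probability_setT mulr1 addNr mul0r.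
have [t <-] := toC_surj (x : circle R).
rewrite (@Rintegral_circle _ (t - pi) _ (pi ^+ 2)); first last.
- move=> y; rewrite normrM -[leRHS]mulr1 ler_pM//; first exact: KB_bounded.
  exact: cosphase_le1.
- by move=> s; apply: cvgM; [exact: continuous_KB|exact: continuous_cosphase].
have K0 : k%:~R != 0 :> R by rewrite intr_eq0.
have [K KE] : exists K : R, k%:~R = K by eexists.
rewrite KE in K0.
(* Two integrations by parts of [A s * cos (K s + a)], where [A] is [KB (toC t)]. *)
pose A (s : R) := pi ^+ 2 / 6 + - 2^-1 * (s + - t) ^+ 2.
pose F (s : R) := K^-1 * (A s * sin (K * s + a)) +
  (- K ^- 2 * ((s + - t) * cos (K * s + a)) + K ^- 3 * sin (K * s + a)).
have pi2 : t - pi < t - pi + 2 * pi by rewrite ltrDl; exact: twopi_gt0.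
have dt s : is_derive s (1 : R) (fun s => s + - t) 1.
  apply: is_derive_replace (is_derive_add (is_derive_id s (1 : R))
    (is_derive_cst (- t) s (1 : R))) _.
  by rewrite addr0.
have dA s : is_derive s (1 : R) A (- (s + - t)).
  apply: is_derive_replace (is_derive_add (is_derive_cst (pi ^+ 2 / 6) s (1 : R))
    (is_derive_scale (- 2^-1) (is_derive_mul (dt s) (dt s)))) _.
  by rewrite add0r; field.
have cA : continuous A.
  by move=> s; exact: is_derive_continuous (dA s).
have -> : \int[leb]_(s in `[t - pi, t - pi + 2 * pi])
      (KB (toC t) (toC s) * cosphase k a (toC s)) =
    \int[leb]_(s in `[t - pi, t - pi + 2 * pi]) (A s * cos (K * s + a)).
  apply: eq_Rintegral => s; rewrite inE/= in_itv/= => ts.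
  rewrite KBE KA_toC; last by rewrite ler_norml; lra.
  by rewrite cosphaseE KE /A; congr (_ * _); ring.
have -> : \int[leb]_(s in `[t - pi, t - pi + 2 * pi]) (A s * cos (K * s + a)) =
    F (t - pi + 2 * pi) - F (t - pi).
  apply: Rintegral_FTC => // s _.
    apply: cvgM; first exact: cA.
    exact: is_derive_continuous (is_derive_cos_affine K a s).
  apply: is_derive_replace (is_derive_add
    (is_derive_scale K^-1 (is_derive_mul (dA s) (is_derive_sin_affine K a s)))
    (is_derive_add (is_derive_scale (- K ^- 2)
      (is_derive_mul (dt s) (is_derive_cos_affine K a s)))
    (is_derive_scale (K ^- 3) (is_derive_sin_affine K a s)))) _.
  by field.
(* At both ends the phase is shifted by a multiple [K pi] with zero sine. The sine terms of [F]
   agree there and cancel; the term with [s - t] changes sign and yields [- cos (K pi) / K^2]. *)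
have cosE : cos (K * (t - pi + 2 * pi) + a) = cos (K * t + a) * cos (K * pi).
  have -> : K * (t - pi + 2 * pi) + a = (K * t + a) + K * pi by ring.
  by rewrite cosD -KE sin_intrpi mulr0 subr0.
have cosE' : cos (K * (t - pi) + a) = cos (K * t + a) * cos (K * pi).
  have -> : K * (t - pi) + a = (K * t + a) - K * pi by ring.
  by rewrite cosB -KE sin_intrpi mulr0 addr0.
have sinE : sin (K * (t - pi + 2 * pi) + a) = sin (K * t + a) * cos (K * pi).
  have -> : K * (t - pi + 2 * pi) + a = (K * t + a) + K * pi by ring.
  by rewrite sinD -KE sin_intrpi mulr0 addr0.
have sinE' : sin (K * (t - pi) + a) = sin (K * t + a) * cos (K * pi).
  have -> : K * (t - pi) + a = (K * t + a) - K * pi by ring.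
  by rewrite sinB -KE sin_intrpi mulr0 subr0.
rewrite /F cosE cosE' sinE sinE' circle_lambdaE cosphaseE KE /A.
have : (pi : R) != 0 by rewrite gt_eqF// pi_gt0.
by move: (pi : R) => p p0; field; rewrite K0.
Qed.

End circle_MDS.

(** * Integral estimates on a probability space *)

Section L2_integrals.
Context {d : measure_display} {T : measurableType d} {R : realType}.
Variable mu : probability T R.

Lemma Rintegral_sum (I : Type) (s : seq I) (P : pred I) (F : I -> T -> R) :
  (forall i, mu.-integrable setT (EFin \o F i)) ->
  \int[mu]_x (\sum_(i <- s | P i) F i x) = \sum_(i <- s | P i) \int[mu]_x F i x.
Proof.
move=> iF.
have iS (r : seq I) : mu.-integrable setT (EFin \o (fun x => \sum_(i <- r | P i) F i x)).
  have := @integrable_sum _ _ _ mu setT measurableT I r P _ (fun i _ => iF i).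
  by apply: eq_integrable => // x _; rewrite /= sumEFin.
elim: s => [|i s IH].
  by under eq_Rintegral do rewrite big_nil; rewrite big_nil Rintegral_cst// mul0r.
under eq_Rintegral do rewrite big_cons.
rewrite big_cons; case: (P i) => //.
by rewrite RintegralD// IH.
Qed.

(* AM-GM: [|h| <= e / 2 + h ^ 2 / (2 e)]. *)
Lemma Rintegral_norm_le (h : T -> R) (e : R) : h \in Lfun mu 2%:E -> 0 < e ->
  \int[mu]_x h x ^+ 2 <= e ^+ 2 -> \int[mu]_x `|h x| <= e.
Proof.
move=> hL e0 he; have /Lfun2P[mh hi] := hL.
have i1 : mu.-integrable setT (EFin \o (fun x => (2 * e)^-1 * h x ^+ 2)).
  by have := integrableZl measurableT (2 * e)^-1 hi.
have i2 : mu.-integrable setT (EFin \o (fun=> e / 2)).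
  by apply: bounded_measurable_integrable; split => //; exists `|e / 2|.
have hle x : `|h x| <= (2 * e)^-1 * h x ^+ 2 + e / 2.
  rewrite -real_normK ?num_real//; move: (`|h x|) => a.
  rewrite -subr_ge0.
  have -> : (2 * e)^-1 * a ^+ 2 + e / 2 - a = (2 * e)^-1 * (a - e) ^+ 2.
    by field; rewrite gt_eqF.
  by rewrite mulr_ge0 ?sqr_ge0// invr_ge0 mulr_ge0// ltW.
have i12 : mu.-integrable setT (EFin \o (fun x => (2 * e)^-1 * h x ^+ 2 + e / 2)).
  by have := integrableD measurableT i1 i2.
have ih : mu.-integrable setT (EFin \o (fun x => `|h x|)).
  apply: le_integrable i12 => //.
    by apply/measurable_EFinP; exact: measurableT_comp.
  move=> x _ /=; rewrite lee_fin normr_id (le_trans (hle x))//.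
  exact: ler_norm.
apply: (@le_trans _ _ (\int[mu]_x ((2 * e)^-1 * h x ^+ 2 + e / 2))).
  by apply: le_Rintegral.
rewrite RintegralD// (@RintegralZl _ _ _ mu setT (fun x => h x ^+ 2))//.
rewrite Rintegral_cst//= probability_setT mulr1.
apply: (@le_trans _ _ ((2 * e)^-1 * e ^+ 2 + e / 2)).
  by rewrite lerD2r ler_wpM2l// invr_ge0 mulr_ge0// ltW.
by rewrite le_eqVlt; apply/orP; left; apply/eqP; field; rewrite gt_eqF.
Qed.

Lemma ae_exists (P : T -> Prop) : {ae mu, forall x, P x} -> exists x, P x.
Proof.
case=> N [mN N0 PN]; apply: contrapT => /forallNP nP; move: N0.
rewrite (_ : N = setT); first by rewrite probability_setT => /eqP; rewrite onee_eq0.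
by apply/seteqP; split=> // x _; apply: PN; exact: nP.
Qed.

Lemma ae_Rintegral_le (u : T -> R) (C : R) :
  mu.-integrable setT (EFin \o u) -> {ae mu, forall x, `|u x| <= C} ->
  `|\int[mu]_x u x| <= C.
Proof.
move=> iu uC; apply: le_trans (le_normr_Rintegral _ iu) _ => //.
have iu' := integrable_norm iu.
rewrite -lee_fin fineK; last exact: integrable_fin_num.
have C0 : 0 <= C.
  by have [x] := ae_exists uC; exact: le_trans.
rewrite -[leRHS]mule1 -(probability_setT mu) -(integral_cst mu measurableT).
apply: ae_ge0_le_integral => //.
- exact: measurable_int iu'.
- by apply: filterS uC => x ux _; rewrite lee_fin.
Qed.

Lemma Rintegral_sqr_gt0_nae0 (f : T -> R) : measurable_fun setT f ->
  0 < \int[mu]_x (f x * f x) -> ~ (f = (fun=> 0) %[ae mu]).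
Proof.
move=> mf + f0; suff -> : \int[mu]_x (f x * f x) = 0 by rewrite ltxx.
rewrite /Rintegral (ae_eq_integral (fun=> 0%E))//.
- by rewrite integral0.
- by apply/measurable_EFinP; exact: measurable_funM.
- by apply: filterS f0 => x fx _ /=; rewrite fx// mulr0.
Qed.

Lemma Rintegral_sqr_eq0_ae (f : T -> R) : f \in Lfun mu 2%:E ->
  \int[mu]_x f x ^+ 2 = 0 -> f = (fun=> 0) %[ae mu].
Proof.
move=> /Lfun2P[mf fi] f0.
have : (\int[mu]_x `|(f x ^+ 2)%:E| = 0)%E.
  under eq_integral do rewrite gee0_abs ?lee_fin ?sqr_ge0//.
  by rewrite -[LHS]fineK ?integrable_fin_num//; congr EFin.
move/(ae_eq_integral_abs mu measurableT (measurable_int _ fi)).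
apply: filterS => x /= /(_ I) [] /eqP; rewrite sqrf_eq0 => /eqP fx _.
exact: fx.
Qed.

End L2_integrals.

(** * Arbitrary eigenfunctions tested against the trigonometric modes *)

Section circle_eigen.
Context {R : realType}.
Local Notation mu := (circle_measure R).
Local Notation KB := (@KB R (mm_circle R)).
Local Notation TKB := (TKB (mm_circle R)).
Implicit Types (f g h p : borel (circle R) -> R) (k l : int) (a b : R).

Let KBM_integrable x h : h \in Lfun mu 2%:E ->
  mu.-integrable setT (EFin \o (fun y => KB x y * h y)).
Proof.
move=> hL; apply: Lfun2M_integrable => //.
exact/bounded_measurable_Lfun2/KB_bounded_measurable.
Qed.

Lemma TKBD f g : f \in Lfun mu 2%:E -> g \in Lfun mu 2%:E ->
  TKB (fun x => f x + g x) = fun x => TKB f x + TKB g x.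
Proof.
move=> fL gL; apply/funext => x; rewrite /Defs.TKB/=.
under eq_Rintegral do rewrite mulrDr.
by rewrite RintegralD//; exact: KBM_integrable.
Qed.

Lemma TKBZ (c : R) f : f \in Lfun mu 2%:E ->
  TKB (fun x => c * f x) = fun x => c * TKB f x.
Proof.
move=> fL; apply/funext => x; rewrite /Defs.TKB/=.
under eq_Rintegral do rewrite mulrCA.
by rewrite RintegralZl//; exact: KBM_integrable.
Qed.

Lemma TKBB f g : f \in Lfun mu 2%:E -> g \in Lfun mu 2%:E ->
  TKB (fun x => f x - g x) = fun x => TKB f x - TKB g x.
Proof.
move=> fL gL.
have := TKBD fL (Lfun2Z (-1) gL); rewrite TKBZ//.
under eq_fun do rewrite mulN1r.
by move=> ->; apply/funext => x; rewrite mulN1r.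
Qed.

(** The kernel is bounded by [pi^2], and on a probability space the L^1 norm is at most the L^2
    norm. *)
Lemma TKB_le h (e : R) : h \in Lfun mu 2%:E -> 0 < e ->
  \int[mu]_x h x ^+ 2 <= e ^+ 2 -> forall x, `|TKB h x| <= pi ^+ 2 * e.
Proof.
move=> hL e0 he x; rewrite /Defs.TKB/=.
have iKh := KBM_integrable x hL.
apply: le_trans (le_normr_Rintegral _ iKh) _ => //.
have /Lfun2P[mh _] := hL.
have ih : mu.-integrable setT (EFin \o (fun x => `|h x|)).
  apply: (integrable_norm (f := h)); apply/Lfun1_integrable.
  exact: Lfun_subset12 (fin_num_measure _ _ measurableT) _ hL.
apply: (@le_trans _ _ (\int[mu]_y (pi ^+ 2 * `|h y|))).
  apply: le_Rintegral => //.
  - exact: (integrable_norm iKh).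
  - by have := integrableZl measurableT (pi ^+ 2) ih.
  - by move=> y _; rewrite normrM ler_wpM2r//; exact: KB_bounded.
by rewrite RintegralZl// ler_wpM2l ?sqr_ge0//; exact: Rintegral_norm_le.
Qed.

Lemma cosphase_Lfun2 k a : cosphase k a \in Lfun mu 2%:E.
Proof. exact/bounded_measurable_Lfun2/cosphase_bounded_measurable. Qed.

Lemma trigpoly_Lfun2 p : trigpoly p -> p \in Lfun mu 2%:E.
Proof. by move=> /trigpoly_bounded_measurable; exact: bounded_measurable_Lfun2. Qed.

Lemma Rintegral_cosphaseM k a l b : \int[mu]_x (cosphase k a x * cosphase l b x) =
  2^-1 * ((k + l == 0)%:R * cos (a + b)) + 2^-1 * ((k == l)%:R * cos (a - b)).
Proof.
under eq_Rintegral do rewrite cosphaseM.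
have ic j c : mu.-integrable setT (EFin \o (cosphase j c)).
  exact/bounded_measurable_integrable/cosphase_bounded_measurable.
have ic2 j c : mu.-integrable setT (EFin \o (fun x => 2^-1 * cosphase j c x)).
  by have := integrableZl measurableT 2^-1 (ic j c).
by rewrite RintegralD// !RintegralZl// !Rintegral_cosphase subr_eq0.
Qed.

Lemma trigpoly_TKB p : trigpoly p -> trigpoly (TKB p) /\
  forall k a, \int[mu]_x (TKB p x * cosphase k a x) =
    circle_lambda k * \int[mu]_x (p x * cosphase k a x).
Proof.
move=> tp; suff [] : trigpoly p /\ (trigpoly (TKB p) /\
  forall k a, \int[mu]_x (TKB p x * cosphase k a x) =
    circle_lambda k * \int[mu]_x (p x * cosphase k a x)) by [].
move: p tp; apply: trigpoly_ind => [|c j b p [tp [tTp Tp]]].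
  have T0 : TKB (fun=> 0) = fun=> 0.
    have := TKBZ 0 (cosphase_Lfun2 0 0); under eq_fun do rewrite mul0r.
    by move=> ->; apply/funext => x; rewrite mul0r.
  split; first exact: trigpoly_cst.
  rewrite T0; split; first exact: trigpoly_cst.
  move=> k a; under eq_Rintegral do rewrite mul0r.
  by rewrite Rintegral_cst// mul0r mulr0.
have tc := trigpoly_cosphase j b.
have cL := trigpoly_Lfun2 (trigpolyZ c tc).
split; first by apply: trigpolyD => //; exact: trigpolyZ.
rewrite TKBD//; last exact: trigpoly_Lfun2.
rewrite TKBZ ?cosphase_Lfun2// TKB_cosphase; split.
  by apply: trigpolyD => //; apply: trigpolyZ; exact: trigpolyZ.
move=> k a.
have i1 : mu.-integrable setT (EFin \o (fun x => cosphase j b x * cosphase k a x)).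
  by apply: Lfun2M_integrable; exact: cosphase_Lfun2.
have iZ (z : R) : mu.-integrable setT
    (EFin \o (fun x => z * (cosphase j b x * cosphase k a x))).
  by have := integrableZl measurableT z i1.
have i2 : mu.-integrable setT (EFin \o (fun x => TKB p x * cosphase k a x)).
  by apply: Lfun2M_integrable; [exact: trigpoly_Lfun2|exact: cosphase_Lfun2].
have i3 : mu.-integrable setT (EFin \o (fun x => p x * cosphase k a x)).
  by apply: Lfun2M_integrable; [exact: trigpoly_Lfun2|exact: cosphase_Lfun2].
have -> : \int[mu]_x ((c * (circle_lambda j * cosphase j b x) + TKB p x)
      * cosphase k a x) =
    \int[mu]_x (c * circle_lambda j * (cosphase j b x * cosphase k a x)
      + TKB p x * cosphase k a x).
  by apply: eq_Rintegral => x _; move: (circle_lambda j) => z; ring.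
under [in RHS]eq_Rintegral do rewrite mulrDl -mulrA.
rewrite !RintegralD// !RintegralZl// Tp mulrDr; congr (_ + _).
rewrite [RHS]mulrCA -[LHS]mulrA; congr (_ * _); rewrite Rintegral_cosphaseM.
have [->|jk] := eqVneq j k; first by [].
have [/eqP|jk'] := eqVneq (j + k) 0; last by rewrite !mul0r !mulr0 addr0 !mulr0.
by rewrite addr_eq0 => /eqP ->; rewrite circle_lambdaN.
Qed.

(* The symmetry [<T f, phi> = <f, T phi>], obtained by approximating [f] by
   trigonometric polynomials, on which [T] is diagonal. *)
Lemma reigenfunction_dot (l : R) f k a : reigenfunction mu TKB l f ->
  (l - circle_lambda k) * \int[mu]_x (f x * cosphase k a x) = 0.
Proof.
move=> [fL _ Tf]; apply/eqP; rewrite -normr_eq0 eq_le normr_ge0 andbT.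
apply/ler_addgt0Pl => e e0; rewrite addr0.
have [la laE] : exists la : R, circle_lambda k = la by eexists.
rewrite laE.
have C0 : 0 < pi ^+ 2 + `|la| by rewrite ltr_pwDl// exprn_gt0// pi_gt0.
pose eta := e / (pi ^+ 2 + `|la|).
have eta0 : 0 < eta by rewrite divr_gt0.
have [p tp fp] := trigpoly_dense fL (exprn_gt0 2 eta0).
have pL := trigpoly_Lfun2 tp.
have [tTp Tp] := trigpoly_TKB tp.
have TpL := trigpoly_Lfun2 tTp.
have fpL := Lfun2B fL pL.
have {}fp : \int[mu]_x (f x - p x) ^+ 2 <= eta ^+ 2.
  by rewrite -lee_fin fineK ?ltW//; exact: sqdist_fin_num.
have fpc : `|\int[mu]_x ((f x - p x) * cosphase k a x)| <= eta.
  have i := Lfun2M_integrable fpL (cosphase_Lfun2 k a).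
  apply: le_trans (le_normr_Rintegral _ i) _ => //.
  apply: le_trans (Rintegral_norm_le fpL eta0 fp).
  apply: le_Rintegral => //.
  - exact: (integrable_norm i).
  - apply: (integrable_norm (f := fun x => f x - p x)); apply/Lfun1_integrable.
    exact: Lfun_subset12 (fin_num_measure _ _ measurableT) _ fpL.
  - by move=> x _; rewrite normrM ler_piMr//; exact: cosphase_le1.
have lfL := Lfun2Z l fL.
have dL := Lfun2B lfL TpL.
have Tfpc : `|\int[mu]_x ((l * f x - TKB p x) * cosphase k a x)| <= pi ^+ 2 * eta.
  apply: ae_Rintegral_le; first exact: (Lfun2M_integrable dL (cosphase_Lfun2 k a)).
  apply: filterS Tf => x /(_ I) <-.
  rewrite normrM -[leRHS]mulr1 ler_pM//; last exact: cosphase_le1.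
  have := TKB_le fpL eta0 fp x.
  by rewrite TKBB.
have -> : (l - la) * \int[mu]_x (f x * cosphase k a x) =
  \int[mu]_x ((l * f x - TKB p x) * cosphase k a x)
  - la * \int[mu]_x ((f x - p x) * cosphase k a x).
  under [in RHS]eq_Rintegral do rewrite mulrBl -mulrA.
  under [X in _ = _ - _ * X]eq_Rintegral do rewrite mulrBl.
  have ifc := Lfun2M_integrable fL (cosphase_Lfun2 k a).
  have ilfc : mu.-integrable setT (EFin \o (fun x => l * (f x * cosphase k a x))).
    by have := integrableZl measurableT l ifc.
  have ipc := Lfun2M_integrable pL (cosphase_Lfun2 k a).
  have iTpc := Lfun2M_integrable TpL (cosphase_Lfun2 k a).
  by rewrite !RintegralB// RintegralZl// Tp laE; ring.
apply: le_trans (ler_normB _ _) _.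
have -> : e = pi ^+ 2 * eta + `|la| * eta.
  by rewrite -mulrDl /eta mulrC divfK// gt_eqF.
by rewrite lerD// normrM ler_wpM2l.
Qed.

Lemma cosphase_complete g : g \in Lfun mu 2%:E ->
  (forall k a, \int[mu]_x (g x * cosphase k a x) = 0) -> g = (fun=> 0) %[ae mu].
Proof.
move=> gL g0; apply: Rintegral_sqr_eq0_ae => //.
apply/eqP; rewrite eq_le; apply/andP; split; last first.
  by apply: Rintegral_ge0 => x _; exact: sqr_ge0.
apply/ler_addgt0Pl => e e0; rewrite addr0.
have [p tp gp] := trigpoly_dense gL e0.
have pL := trigpoly_Lfun2 tp.
have gp0 : \int[mu]_x (g x * p x) = 0.
  suff [] : trigpoly p /\ \int[mu]_x (g x * p x) = 0 by [].
  move: p tp {gp pL}; apply: trigpoly_ind => [|c k a p [tp IH]].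
    split; first exact: trigpoly_cst.
    by under eq_Rintegral do rewrite mulr0; rewrite Rintegral_cst// mul0r.
  split; first by apply: trigpolyD => //; apply: trigpolyZ; exact: trigpoly_cosphase.
  under eq_Rintegral do rewrite mulrDr mulrCA.
  have ic := Lfun2M_integrable gL (cosphase_Lfun2 k a).
  rewrite RintegralD//; last 2 first.
  - by have := integrableZl measurableT c ic.
  - by apply: Lfun2M_integrable => //; exact: trigpoly_Lfun2.
  by rewrite RintegralZl// g0 mulr0 add0r.
have {gp} : \int[mu]_x (g x - p x) ^+ 2 <= e.
  by rewrite -lee_fin fineK ?ltW//; exact: sqdist_fin_num.
apply: le_trans.
have /Lfun2P[_ ig] := gL.
have igp := Lfun2M_integrable gL pL.
have igp2 : mu.-integrable setT (EFin \o (fun x => 2 * (g x * p x))).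
  by have := integrableZl measurableT 2 igp.
have -> : \int[mu]_x g x ^+ 2 = \int[mu]_x (g x ^+ 2 - 2 * (g x * p x)).
  by rewrite RintegralB// RintegralZl// gp0 mulr0 subr0.
apply: le_Rintegral => //.
- by have := integrableB measurableT ig igp2.
- by have /Lfun2P[] := Lfun2B gL pL.
- move=> x _.
  have -> : (g x - p x) ^+ 2 = (g x ^+ 2 - 2 * (g x * p x)) + p x ^+ 2 by ring.
  by rewrite lerDl sqr_ge0.
Qed.

End circle_eigen.

(** * Fourier basis and MDS embedding *)

Section circle_exp.
Context {R : realType}.
Local Notation mu := (circle_measure R).
Local Notation KB := (@KB R (mm_circle R)).
Implicit Types (k l : int) (x : borel (circle R)).

Lemma circle_exp_cosphase k x :
  circle_exp k x = (cosphase k 0 x +i* cosphase k (- (pi / 2)) x)%C.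
Proof. by rewrite /circle_exp /cosphase addr0 cosBpihalf. Qed.

Lemma circle_exp0 : circle_exp 0 = (fun=> 1) :> (circle R -> R[i]).
Proof. by apply/funext => x; rewrite /circle_exp mul0r cos0 sin0. Qed.

Lemma circle_expM k l x :
  circle_exp k x * circle_exp l x = circle_exp (k + l) x.
Proof.
rewrite /circle_exp intrD mulrDl cosD sinD; apply/eqP; rewrite eq_complex/=.
by rewrite eqxx/=; apply/eqP; ring.
Qed.

Lemma circle_expN k x : (circle_exp k x)^*%C = circle_exp (- k) x.
Proof. by rewrite /circle_exp rmorphN/= mulNr cosN sinN. Qed.

Lemma circle_exp_cL2 k : cL2 mu (circle_exp k).
Proof.
by split; under eq_fun do rewrite circle_exp_cosphase /=; exact: cosphase_Lfun2.
Qed.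

Lemma circle_exp_orthonormal : corthonormal mu (circle_exp (R := R)).
Proof.
split; first exact: circle_exp_cL2.
move=> k l; rewrite /cdot /cintegral.
under eq_Rintegral do rewrite circle_expN circle_expM circle_exp_cosphase /=.
under [X in (_ +i* X)%C]eq_Rintegral do
  rewrite circle_expN circle_expM circle_exp_cosphase /=.
rewrite !Rintegral_cosphase subr_eq0 cos0 cosN cos_pihalf mulr0 mulr1.
by case: (k == l).
Qed.

Let span (F : circle R -> R[i]) := exists (s : seq int) (c : int -> R[i]),
  [/\ uniq s, forall k, k \notin s -> c k = 0 &
      F = fun x => \sum_(k <- s) c k * circle_exp k x].

Let span_widen (s r : seq int) (c : int -> R[i]) x : uniq s -> uniq r ->
  {subset s <= r} -> (forall k, k \notin s -> c k = 0) ->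
  \sum_(k <- s) c k * circle_exp k x = \sum_(k <- r) c k * circle_exp k x.
Proof.
move=> us ur sr c0; rewrite [RHS](bigID (mem s))/= [X in _ + X]big1 ?addr0.
  rewrite -[RHS]big_filter; apply: perm_big; apply: uniq_perm => //.
    exact: filter_uniq.
  by move=> k; rewrite mem_filter andb_idr//; exact: sr.
by move=> k /c0 ->; rewrite mul0r.
Qed.

Let spanD F G : span F -> span G -> span (fun x => F x + G x).
Proof.
move=> [s [c [us c0 ->]]] [r [d [ur d0 ->]]].
exists (undup (s ++ r)), (fun k => c k + d k); split; first exact: undup_uniq.
  move=> k; rewrite mem_undup mem_cat negb_or => /andP[ks kr].
  by rewrite c0// d0// addr0.
apply/funext => x; under [RHS]eq_bigr do rewrite mulrDl.
rewrite big_split/=; congr (_ + _); apply: span_widen => //.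
- exact: undup_uniq.
- by move=> k ks; rewrite mem_undup mem_cat ks.
- exact: undup_uniq.
- by move=> k ks; rewrite mem_undup mem_cat ks orbT.
Qed.

Let span_exp (z : R[i]) k : span (fun x => z * circle_exp k x).
Proof.
exists [:: k], (fun j => if j == k then z else 0); split => //.
  by move=> j; rewrite inE => /negbTE ->.
by apply/funext => x; rewrite big_cons big_nil eqxx addr0.
Qed.

Let span_trigpoly p (w : R[i]) : trigpoly p -> span (fun x => w * (p x)%:C%C).
Proof.
move: p; apply: trigpoly_ind => [|c k a p IH].
  by exists [::], (fun=> 0); split => //; apply/funext => x; rewrite big_nil mulr0.
pose z : R[i] := ((c * cos a / 2) +i* (c * sin a / 2))%C.
have -> : (fun x => w * (c * cosphase k a x + p x)%:C%C) =
    (fun x => (w * z * circle_exp k x + w * z^*%C * circle_exp (- k) x)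
       + w * (p x)%:C%C).
  apply/funext => x; rewrite rmorphD mulrDr; congr (_ + _).
  rewrite -!mulrA -mulrDr; congr (_ * _).
  rewrite -circle_expN /cosphase /circle_exp /z cosD.
  by apply/eqP; rewrite eq_complex/=; apply/andP; split; apply/eqP; field.
apply: spanD => //; apply: spanD; exact: span_exp.
Qed.

Lemma sqr_normc (z : R[i]) :
  Normc.normc z ^+ 2 = complex.Re z ^+ 2 + complex.Im z ^+ 2.
Proof. by case: z => a b /=; rewrite sqr_sqrtr// addr_ge0// sqr_ge0. Qed.

Lemma cL2norm_lt (F : borel (circle R) -> R[i]) (e : R) : 0 < e ->
  (\int[mu]_x (complex.Re (F x) ^+ 2 + complex.Im (F x) ^+ 2)%:E < (e ^+ 2)%:E)%E ->
  (cL2norm mu F < e%:E)%E.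
Proof.
move=> e0 Fe; rewrite ltNge; apply/negP => eF; move: Fe; apply/negP; rewrite -leNgt.
have -> : (\int[mu]_x (complex.Re (F x) ^+ 2 + complex.Im (F x) ^+ 2)%:E
    = cL2norm mu F `^ 2)%E.
  rewrite poweR_Lnorm//; apply: eq_integral => x _.
  rewrite gee0_abs ?lee_fin ?poweR_EFin; last by case: (F x) => a b; exact: sqrtr_ge0.
  rewrite powR_mulrn ?sqr_normc//.
  by case: (F x) => a b; exact: sqrtr_ge0.
have -> : (e ^+ 2)%:E = (e%:E `^ 2)%E.
  by rewrite poweR_EFin powR_mulrn// ltW.
by apply: gt0_ler_poweR => //; rewrite in_itv/= ?leey ?andbT ?lee_fin ?(ltW e0)// Lnorm_ge0.
Qed.

Lemma circle_exp_basis : corthonormal_basis mu (circle_exp (R := R)).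
Proof.
split; first exact: circle_exp_orthonormal.
move=> f [fr fi] e e0.
have e2 : 0 < e ^+ 2 / 2 by rewrite divr_gt0// exprn_gt0.
have [p tp fp] := trigpoly_dense fr e2.
have [q tq fq] := trigpoly_dense fi e2.
have [s [c [_ _ sc]]] := spanD (span_trigpoly 1 tp) (span_trigpoly 'i%C tq).
exists s, c; apply: cL2norm_lt => //.
have -> : (\int[mu]_x ((complex.Re (f x - \sum_(i <- s) c i * circle_exp i x)) ^+ 2 +
     (complex.Im (f x - \sum_(i <- s) c i * circle_exp i x)) ^+ 2)%:E =
   \int[mu]_x (((complex.Re (f x) - p x) ^+ 2)%:E +
     ((complex.Im (f x) - q x) ^+ 2)%:E))%E.
  apply: eq_integral => x _; rewrite -EFinD; congr EFin.
  have -> : \sum_(i <- s) c i * circle_exp i x = (p x +i* q x)%C.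
    rewrite -[LHS]/((fun x => \sum_(i <- s) c i * circle_exp i x) x) -sc mul1r.
    by apply/eqP; rewrite eq_complex/=; apply/andP; split; apply/eqP; ring.
  by case: (f x).
have mB (u v : borel (circle R) -> R) : u \in Lfun mu 2%:E -> trigpoly v ->
    measurable_fun setT (fun x => ((u x - v x) ^+ 2)%:E).
  move=> /Lfun2_measurable mu_ /trigpoly_bounded_measurable[mv _].
  by apply/measurable_EFinP/measurable_funX/measurable_funB.
rewrite ge0_integralD//.
- by rewrite [e ^+ 2]splitr EFinD lteD.
- by move=> x _; rewrite lee_fin sqr_ge0.
- exact: mB.
- by move=> x _; rewrite lee_fin sqr_ge0.
- exact: mB.
Qed.

Lemma circle_exp_ceigenfunction k :
  ceigenfunction mu (cTKB (mm_circle R)) (circle_lambda k)%:C%C (circle_exp k).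
Proof.
split; first exact: circle_exp_cL2.
  move=> /(@ae_exists _ _ _ mu)[x /(_ I)] /eqP; rewrite eq_complex/=.
  move=> /andP[/eqP c0 /eqP s0]; have := cos2Dsin2 (k%:~R * angle x).
  by rewrite c0 s0 expr0n/= addr0 => /eqP; rewrite eq_sym oner_eq0.
apply: aeW => x _; rewrite /cTKB /cintegral.
have -> : \int[mm_measure (mm_circle R)]_y complex.Re ((KB x y)%:C%C * circle_exp k y) =
    circle_lambda k * cosphase k 0 x.
  rewrite -[RHS]/((fun x => circle_lambda k * cosphase k 0 x) x) -TKB_cosphase.
  by apply: eq_Rintegral => y _; rewrite circle_exp_cosphase/= mul0r subr0.
have -> : \int[mm_measure (mm_circle R)]_y complex.Im ((KB x y)%:C%C * circle_exp k y) =
    circle_lambda k * cosphase k (- (pi / 2)) x.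
  rewrite -[RHS]/((fun x => circle_lambda k * cosphase k (- (pi / 2)) x) x) -TKB_cosphase.
  by apply: eq_Rintegral => y _; rewrite circle_exp_cosphase/= mul0r addr0.
rewrite circle_exp_cosphase; apply/eqP; rewrite eq_complex/=.
by rewrite !mul0r subr0 addr0 !eqxx.
Qed.

End circle_exp.

Section circle_real.
Context {R : realType}.
Local Notation mu := (circle_measure R).
Local Notation TKB := (TKB (mm_circle R)).
Implicit Types (b c : bool) (m n : nat).

Let phase b : R := if b then - (pi / 2) else 0.

Let cos_phaseB b c : cos (phase b - phase c) = (b == c)%:R.
Proof.
by case: b; case: c; rewrite /phase ?subrr ?cos0// ?subr0 ?sub0r ?opprK ?cosN cos_pihalf.
Qed.

Definition circle_trig b n : borel (circle R) -> R :=
  if b then circle_sin n else circle_cos n.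

Lemma circle_trig_cosphase b n :
  circle_trig b n = fun x => Num.sqrt 2 * cosphase n (phase b) x.
Proof.
apply/funext => x; case: b; first by rewrite /cosphase cosBpihalf.
by rewrite /cosphase addr0.
Qed.

Let sqrt2M : Num.sqrt 2 * Num.sqrt 2 = 2 :> R.
Proof. by rewrite -expr2 sqr_sqrtr. Qed.

Let sqrt2_neq0 : Num.sqrt 2 != 0 :> R.
Proof. by rewrite sqrtr_eq0 -ltNge. Qed.

Lemma circle_trig_Lfun2 b n : circle_trig b n \in Lfun mu 2%:E.
Proof. by rewrite circle_trig_cosphase; apply: Lfun2Z; exact: cosphase_Lfun2. Qed.

Lemma Rintegral_circle_trig_cosphase b m c n : (0 < m)%N ->
  \int[mu]_x (circle_trig b m x * cosphase n (phase c) x) =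
  (Num.sqrt 2)^-1 * ((b == c) && (m == n))%:R.
Proof.
move=> m0; rewrite circle_trig_cosphase.
under eq_Rintegral do rewrite -mulrA.
rewrite RintegralZl//; last by apply: Lfun2M_integrable; exact: cosphase_Lfun2.
rewrite Rintegral_cosphaseM -PoszD.
have -> : (Posz (m + n) == 0) = false by case: m m0.
rewrite mul0r mulr0 add0r cos_phaseB eqz_nat.
have -> : (Num.sqrt 2)^-1 = Num.sqrt 2 / 2 :> R.
  by rewrite -[X in _ / X]sqrt2M; field.
by rewrite -!mulrA andbC; case: (m == n); case: (b == c); rewrite !(mul1r, mul0r).
Qed.

Lemma rdot_circle_trig b m c n : (0 < m)%N ->
  rdot mu (circle_trig b m) (circle_trig c n) = ((b == c) && (m == n))%:R.
Proof.
move=> m0; rewrite /rdot [circle_trig c n]circle_trig_cosphase.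
under eq_Rintegral do rewrite mulrCA.
rewrite RintegralZl//; last first.
  by apply: Lfun2M_integrable; [exact: circle_trig_Lfun2|exact: cosphase_Lfun2].
by rewrite Rintegral_circle_trig_cosphase// mulrA divff// mul1r.
Qed.

Lemma circle_trig_reigenfunction b n : (0 < n)%N ->
  reigenfunction mu TKB (circle_lambda n) (circle_trig b n).
Proof.
move=> n0; split; first exact: circle_trig_Lfun2.
  apply: Rintegral_sqr_gt0_nae0; first exact/Lfun2_measurable/circle_trig_Lfun2.
  by have := rdot_circle_trig b b n n0; rewrite /rdot => ->; rewrite !eqxx.
apply: aeW => x _; rewrite circle_trig_cosphase TKBZ ?cosphase_Lfun2//.
by rewrite TKB_cosphase mulrCA.
Qed.

Lemma circle_lambda_nat n :
  circle_lambda n = (-1) ^+ n.+1 / n%:R ^+ 2 :> R.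
Proof. by rewrite /circle_lambda -[n%:Z + 1]/(Posz (n + 1)) addn1. Qed.

Lemma freqE n : freq n = (2 * n./2).+1.
Proof. by rewrite /freq mul2n. Qed.

Lemma leq_freq n : (n <= freq n)%N.
Proof. by rewrite /freq -[leqLHS]odd_double_half -add1n leq_add2r; case: odd. Qed.

Lemma circle_mds_phiE n : circle_mds_phi n = circle_trig (odd n) (freq n).
Proof. by rewrite /circle_mds_phi /circle_trig; case: odd. Qed.

Lemma circle_mds_lambdaE n : circle_mds_lambda n = ((freq n)%:R ^+ 2)^-1 :> R.
Proof.
rewrite /circle_mds_lambda circle_lambda_nat -signr_odd /freq /= odd_double.
by rewrite expr0 mul1r.
Qed.

Lemma eq_freq_odd m n : (odd m == odd n) && (freq m == freq n) = (m == n).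
Proof.
apply/idP/eqP => [/andP[/eqP mn]|->]; last by rewrite !eqxx.
rewrite /freq eqSS => /eqP h.
by rewrite -(odd_double_half m) -(odd_double_half n) mn h.
Qed.

Lemma freq_surj b n : exists m, odd m = b /\ freq m = (n.*2).+1.
Proof.
exists (b + n.*2)%N; split; first by rewrite oddD odd_double addbF oddb.
by rewrite /freq half_bit_double.
Qed.

Lemma circle_mds_eigensystem :
  mds_eigensystem (mm_circle R) circle_mds_lambda circle_mds_phi.
Proof.
split.
- apply/nonincreasing_seqP => n; rewrite !circle_mds_lambdaE.
  rewrite lef_pV2 ?posrE ?exprn_gt0 ?ltr0n// lerXn2r ?nnegrE// ler_nat.
  by rewrite /freq ltnS leq_double half_leq.
- split=> [i|i j]; first by rewrite circle_mds_phiE; exact: circle_trig_Lfun2.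
  by rewrite !circle_mds_phiE rdot_circle_trig// eq_freq_odd.
- by move=> i; rewrite circle_mds_phiE; exact: circle_trig_reigenfunction.
move=> l f l0 ef; have [fL _ _] := ef.
pose N := (Num.truncn l^-1).+1.
have ltN i : circle_mds_lambda i = l -> (i < N)%N.
  move=> il; rewrite -(ltr_nat R); apply: le_lt_trans (truncnS_gt _).
  rewrite -il circle_mds_lambdaE invrK -natrX ler_nat.
  by apply: leq_trans (leq_freq i) _; rewrite -{1}[freq i]expn1 leq_pexp2l.
pose c i := \int[mu]_x (f x * circle_mds_phi i x).
exists N, c.
have phiL i : circle_mds_phi i \in Lfun mu 2%:E.
  by rewrite circle_mds_phiE; exact: circle_trig_Lfun2.
pose S (x : borel (circle R)) : R :=
  \sum_(i < N | circle_mds_lambda i == l) c i * circle_mds_phi i x.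
have cphiL i : (fun x => c i * circle_mds_phi i x) \in Lfun mu 2%:E by exact: Lfun2Z.
have SL : S \in Lfun mu 2%:E.
  rewrite /S; elim: (index_enum _) => [|i s IH].
    under eq_fun do rewrite big_nil.
    by apply: bounded_measurable_Lfun2; split => //; exists 0 => x; rewrite normr0.
  under eq_fun do rewrite big_cons.
  by case: (circle_mds_lambda i == l) => //; exact: Lfun2D.
suff : (fun x => f x - S x) = (fun=> 0) %[ae mu].
  apply: filterS => x + _ => /(_ I) /eqP.
  by rewrite subr_eq0 => /eqP.
have key b m : \int[mu]_x ((f x - S x) * cosphase m (phase b) x) = 0.
  have cL := cosphase_Lfun2 m (phase b).
  have iS i : mu.-integrable setT
      (EFin \o (fun x => c i * (circle_mds_phi i x * cosphase m (phase b) x))).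
    by have := integrableZl measurableT (c i) (Lfun2M_integrable (phiL i) cL).
  under eq_Rintegral do rewrite mulrBl.
  rewrite RintegralB//; [|exact: Lfun2M_integrable|exact: Lfun2M_integrable].
  have -> : \int[mu]_x (S x * cosphase m (phase b) x) =
      \sum_(i < N | circle_mds_lambda i == l)
        c i * ((Num.sqrt 2)^-1 * ((odd i == b) && (freq i == m))%:R).
    under eq_Rintegral do rewrite /S mulr_suml.
    under eq_Rintegral do under eq_bigr do rewrite -mulrA.
    rewrite Rintegral_sum//; apply: eq_bigr => i _.
    rewrite RintegralZl//; last exact: Lfun2M_integrable.
    by rewrite circle_mds_phiE Rintegral_circle_trig_cosphase.
  apply/eqP; rewrite subr_eq0; apply/eqP.
  have := reigenfunction_dot m (phase b) ef => /eqP; rewrite mulf_eq0.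
  have [lE _|lN] := eqVneq (circle_lambda m) l; last first.
    rewrite subr_eq0 eq_sym (negbTE lN)/= => /eqP ->; rewrite big1// => i /eqP il.
    case: eqP => [_|]; last by rewrite /= !mulr0.
    case: eqP => [im|]; last by rewrite /= !mulr0.
    by move: lN; rewrite -il /circle_mds_lambda im eqxx.
  have [j [jb jm]] : exists j, odd j = b /\ freq j = m.
    have mo : odd m.
      move: l0; rewrite -lE circle_lambda_nat -signr_odd /=.
      case: (odd m) => //=; rewrite expr1 mulN1r oppr_gt0 invr_lt0.
      by rewrite ltNge sqr_ge0.
    have [j [jb jm]] := freq_surj b m./2; exists j; split => //.
    by rewrite jm -[RHS]odd_double_half mo.
  have jl : circle_mds_lambda j = l by rewrite /circle_mds_lambda jm.
  rewrite (bigD1 (Ordinal (ltN j jl)))/=; last by rewrite jl.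
  rewrite [X in _ = _ + X]big1 ?addr0; last first.
    move=> i /andP[_ ij]; rewrite -jb -jm eq_freq_odd.
    have -> : (i == j :> nat) = false.
      by apply/negbTE; apply: contra ij => /eqP ij; apply/eqP/val_inj.
    by rewrite !mulr0.
  rewrite jb jm !eqxx/= mulr1 /c circle_mds_phiE circle_trig_cosphase jb jm.
  under [X in _ = X * _]eq_Rintegral do rewrite mulrCA.
  by rewrite RintegralZl//; [rewrite mulrAC divff// mul1r|exact: Lfun2M_integrable].
apply: cosphase_complete; first exact: Lfun2B.
have key0 m a : \int[mu]_x ((f x - S x) * cosphase (Posz m) a x) = 0.
  under eq_Rintegral do rewrite cosphaseD mulrBr mulrCA (mulrCA _ (sin a)).
  have i0 b : mu.-integrable setT (EFin \o (fun x => (f x - S x) * cosphase m (phase b) x)).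
    by apply: Lfun2M_integrable; [exact: Lfun2B|exact: cosphase_Lfun2].
  have iZ b (z : R) : mu.-integrable setT
      (EFin \o (fun x => z * ((f x - S x) * cosphase m (phase b) x))).
    by have := integrableZl measurableT z (i0 b).
  rewrite RintegralB//; [|exact: (iZ false)|exact: (iZ true)].
  rewrite !RintegralZl//; [|exact: (i0 true)|exact: (i0 false)].
  by rewrite (key false) (key true) !mulr0 subr0.
case=> m a; first exact: key0.
under eq_Rintegral do rewrite NegzE cosphaseN.
exact: key0.
Qed.

Lemma circle_mds_embedding (t : R) :
  mds_embedding (mm_circle R) circle_mds_lambda circle_mds_phi (toC t) = gamma t.
Proof.
apply/funext => n; rewrite /mds_embedding circle_mds_lambdaE.
rewrite max_l ?invr_ge0 ?sqr_ge0// -exprVn sqrtr_sqr ger0_norm ?invr_ge0//.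
rewrite /gamma /circle_mds_phi.
by case: (odd n); rewrite ?circle_sinE ?circle_cosE mulrCA.
Qed.

Let sum_gamma_sqr (t : R) n :
  \sum_(k < 2 * n) gamma t k ^+ 2 = \sum_(k < n) 2 / (2 * k).+1%:R ^+ 2.
Proof.
elim: n => [|n IH]; first by rewrite !big_ord0.
rewrite mulnS 2!big_ord_recr [RHS]big_ord_recr /= IH -addrA; congr (_ + _).
rewrite /gamma !freqE /=.
have -> : odd (2 * n) = false by rewrite mul2n odd_double.
have -> : uphalf (2 * n) = n by rewrite mul2n uphalf_double.
have -> : (2 * n)./2 = n by rewrite mul2n doubleK.
rewrite /= !exprMn sqr_sqrtr// -mulrDr -mulrDr cos2Dsin2 mulr1 exprVn.
by [].
Qed.

Lemma gamma_norm (t : R) :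
  'N[@counting nat R]_2%:E [EFin \o gamma t]%E = (pi / 2)%:E.
Proof.
rewrite Lnorm_counting//.
have -> : (\sum_(k <oo) `|(EFin \o gamma t) k| `^ 2 = (pi ^+ 2 / 4)%:E)%E.
  pose u k : \bar R := (gamma t k ^+ 2)%:E.
  have uE k : (`|(EFin \o gamma t) k| `^ 2 = u k)%E.
    rewrite /= /u powR_mulrn//.
    by rewrite real_normK// num_real.
  rewrite (eq_eseriesr (fun k _ => uE k)).
  have cu : (\sum_(0 <= k < n) u k)%E @[n --> \oo] --> (\sum_(k <oo) u k)%E.
    by apply: is_cvg_nneseries => k _ _; rewrite lee_fin sqr_ge0.
  have cu2 : (\sum_(0 <= k < 2 * n) u k)%E @[n --> \oo] --> (\sum_(k <oo) u k)%E.
    apply: (cvg_comp (fun n => (2 * n)%N) (fun n => \sum_(0 <= k < n) u k)%E _ cu).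
    move=> A [N _ NA]; exists N => // n /= Nn; apply: NA => /=.
    by rewrite (leq_trans Nn)// mul2n -addnn leq_addr.
  apply: (cvg_unique _ cu2) => //.
  have -> : (fun n => \sum_(0 <= k < 2 * n) u k)%E =
      EFin \o (fun n => \sum_(k < n) 2 / (2 * k).+1%:R ^+ 2).
    apply/funext => n /=; rewrite -(sum_gamma_sqr t) big_mkord sumEFin.
    by [].
  by apply: cvg_EFin; [exact: nearW|exact: cvg_sum_inv_odd_sqr].
rewrite poweR_EFin powR12_sqrt ?divr_ge0 ?sqr_ge0//.
have -> : pi ^+ 2 / 4 = (pi / 2) ^+ 2 :> R by rewrite expr_div_n; congr (_ / _); ring.
by rewrite sqrtr_sqr ger0_norm// divr_ge0// pi_ge0.
Qed.

Lemma gamma_Lfun2 (t : R) : gamma t \in Lfun (@counting nat R) 2%:E.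
Proof.
rewrite inE; apply/andP; split; rewrite inE//=.
by rewrite /finite_norm gamma_norm ltry.
Qed.

End circle_real.

Theorem mainTheorem2 (R : realType) :
  [/\ (* complex eigenfunctions e^(ikx) *)
      [/\ corthonormal_basis (circle_measure R) circle_exp,
          circle_exp 0 = (fun=> 1) :> (circle R -> R[i]),
          ceigenfunction (circle_measure R) (cTKB (mm_circle R)) 0
            (circle_exp 0)
        & forall k : int, k != 0 ->
            ceigenfunction (circle_measure R) (cTKB (mm_circle R))
              ((-1) ^ (k + 1) / k%:~R ^+ 2)%:C%C (circle_exp k)],
      (* real eigenfunctions sqrt 2 cos kx and sqrt 2 sin kx, k >= 1 *)
      rorthonormal (circle_measure R)
        (fun bk : bool * nat =>
           if bk.1 then circle_sin bk.2.+1 else circle_cos bk.2.+1) /\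
      (forall k : nat, (0 < k)%N ->
        reigenfunction (circle_measure R) (TKB (mm_circle R))
          ((-1) ^+ k.+1 / k%:R ^+ 2) (circle_cos k) /\
        reigenfunction (circle_measure R) (TKB (mm_circle R))
          ((-1) ^+ k.+1 / k%:R ^+ 2) (circle_sin k)),
      (* the MDS embedding *)
      mds_eigensystem (mm_circle R) circle_mds_lambda circle_mds_phi /\
      (forall t : R,
        mds_embedding (mm_circle R) circle_mds_lambda circle_mds_phi (toC t)
        = gamma t)
    & (* its image lies in the sphere of radius pi / 2 of l^2 *)
      forall t : R,
        gamma t \in Lfun (@counting nat R) 2%:E /\
        'N[@counting nat R]_2%:E [EFin \o gamma t]%E = (pi / 2)%:E].
Proof.
split.
- split; [exact: circle_exp_basis|exact: circle_exp0| |].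
    by have := @circle_exp_ceigenfunction R 0; rewrite circle_lambda0.
  by move=> k _; exact: circle_exp_ceigenfunction.
- split.
    split=> [[b k]|[b k] [c m]] /=; first exact: (circle_trig_Lfun2 b k.+1).
    have := rdot_circle_trig b c m.+1 (ltn0Sn k).
    by rewrite /circle_trig => ->.
  move=> k k0; rewrite -circle_lambda_nat; split.
    exact: (circle_trig_reigenfunction false k0).
  exact: (circle_trig_reigenfunction true k0).
- by split; [exact: circle_mds_eigensystem|exact: circle_mds_embedding].
- by move=> t; split; [exact: gamma_Lfun2|exact: gamma_norm].
Qed.
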